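(* Let $n$ be a positive integer, $p$ a prime, and $\alpha\in\overline{\mathbb{F}_p}^{\times}$ of multiplicative order $e>n$ with $e\notin\{2,3,4,5,6,10\}$. If $\mathbb{F}_p(\alpha+\alpha^{-1})\neq\mathbb{F}_p(\alpha)=\mathbb{F}_q$, and $R:B_n\to\mathrm{GL}_N(\mathbb{F}_q)$ is an absolutely irreducible representation associated to a partition $\lambda\vdash n$, then there exists $P\in\mathrm{GL}_N(\mathbb{F}_q)$ such that $P R(B_n)P^{-1}\subset\mathrm{GU}_N(q^{1/2})$.
   Context: $B_n$ is the braid group on $n$ strands with Artin generators $\sigma_1,\dots,\sigma_{n-1}$. The Hecke algebra $H_n(\alpha)$ is the quotient of the group algebra $\mathbb{F}_qB_n$ by the relations $(\sigma_i+1)(\sigma_i-\alpha)=0$. Since $e>n$, $H_n(\alpha)$ is split semisimple and its irreducible representations over $\mathbb{F}_q$ are the Specht modules, indexed by the partitions $\lambda$ of $n$; the convention is that for $n=2$ the partition $[2]$ corresponds to $\sigma_1\mapsto -1$ and $[1,1]$ to $\sigma_1\mapsto\alpha$, and that the restriction to $H_{n-1}(\alpha)$ (generated by $\sigma_1,\dots,\sigma_{n-2}$) of the representation associated to $\lambda$ is the direct sum of the representations associated to the partitions of $n-1$ obtained by removing one box from $\lambda$; this determines the labelling. The representation of $B_n$ associated to $\lambda$ is the composite of $B_n\to H_n(\alpha)^\times$ with this representation. When $\mathbb{F}_p(\alpha+\alpha^{-1})\ne\mathbb{F}_p(\alpha)=\mathbb{F}_q$, $q$ is a square and $\mathbb{F}_p(\alpha+\alpha^{-1})=\mathbb{F}_{q^{1/2}}$.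 For a prime power $Q$, $\mathrm{GU}_N(Q)\subset\mathrm{GL}_N(\mathbb{F}_{Q^2})$ is the group of matrices preserving the standard nondegenerate Hermitian form on $\mathbb{F}_{Q^2}^N$ (with respect to $x\mapsto x^Q$). *)

(* Defs.v *)
From HB Require Import structures.
From mathcomp Require Import all_boot all_order all_algebra all_fingroup all_field.
From mathcomp Require Import generic_quotient boolp.

Set Implicit Arguments.
Unset Strict Implicit.
Unset Printing Implicit Defensive.

Import GRing.Theory.

(* B_n is the quotient of the words in the letters sigma_i^{+1}, sigma_i^{-1}
   by the congruence that the inverse and Artin relations generate. The letter
   (i, s) stands for sigma_{i+1}^{-1} if s = true and for sigma_{i+1} if
   s = false: the n - 1 Artin generators are numbered from 0. *)
Definition bword (n : nat) := seq ('I_n.-1 * bool).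

Inductive bcong (n : nat) : bword n -> bword n -> Prop :=
| bcong_refl u : bcong u u
| bcong_sym u v : bcong u v -> bcong v u
| bcong_trans u v w : bcong u v -> bcong v w -> bcong u w
| bcong_cat u u' v v' : bcong u u' -> bcong v v' -> bcong (u ++ v) (u' ++ v')
| bcong_cancel i s : bcong [:: (i, s); (i, ~~ s)] [::]
| bcong_far (i j : 'I_n.-1) : i.+1 < j ->
    bcong [:: (i, false); (j, false)] [:: (j, false); (i, false)]
| bcong_braid (i j : 'I_n.-1) : i.+1 = j ->
    bcong [:: (i, false); (j, false); (i, false)]
          [:: (j, false); (i, false); (j, false)].

Definition bcongb n : rel (bword n) := fun u v => `[< bcong u v >].

Lemma bcongb_refl n : reflexive (@bcongb n).
Proof. by move=> u; apply/asboolP; exact: bcong_refl. Qed.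

Lemma bcongb_sym n : symmetric (@bcongb n).
Proof. by move=> u v; apply/asboolP/asboolP; exact: bcong_sym. Qed.

Lemma bcongb_trans n : transitive (@bcongb n).
Proof.
move=> v u w /asboolP uv /asboolP vw; apply/asboolP; exact: bcong_trans uv vw.
Qed.

Canonical bcong_equiv n :=
  EquivRel (@bcongb n) (@bcongb_refl n) (@bcongb_sym n) (@bcongb_trans n).

Definition braid (n : nat) := {eq_quot bcong_equiv n}%qT.
HB.instance Definition _ n := Choice.on (braid n).
HB.instance Definition _ n := EqQuotient.on (braid n).

Definition bclass n (u : bword n) : braid n := \pi_(braid n)%qT u.

Lemma bclassP n (u v : bword n) : bclass u = bclass v <-> bcong u v.
Proof.
split=> [uv | uv]; first by apply/asboolP/(eqmodP (bcong_equiv n)).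
by apply/(eqmodP (bcong_equiv n)); apply/asboolP.
Qed.

Lemma bclass_repr n (x : braid n) : bclass (repr x) = x.
Proof. exact: reprK. Qed.

Lemma repr_bclass n (u : bword n) : bcong (repr (bclass u)) u.
Proof. by apply/bclassP; rewrite bclass_repr. Qed.

Definition winv n (u : bword n) : bword n := rev [seq (l.1, ~~ l.2) | l <- u].

Lemma winvK n : involutive (@winv n).
Proof.
move=> u; rewrite /winv map_rev revK -map_comp -[RHS]map_id.
by apply: eq_map => -[i s] /=; rewrite negbK.
Qed.

Lemma winv_cat n (u v : bword n) : winv (u ++ v) = winv v ++ winv u.
Proof. by rewrite /winv map_cat rev_cat. Qed.

Lemma bcong_mulwV n (u : bword n) : bcong (u ++ winv u) [::].
Proof.
elim: u => [|[i s] u IHu]; first exact: bcong_refl.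
have e1 : (i, s) :: u ++ winv u ++ [:: (i, ~~ s)] =
          [:: (i, s)] ++ (u ++ winv u) ++ [:: (i, ~~ s)] by rewrite -catA.
rewrite -cat1s winv_cat -!catA cat1s e1.
apply: bcong_trans (bcong_cancel i s).
apply: (bcong_cat (bcong_refl [:: (i, s)])).
exact: (bcong_cat IHu (bcong_refl [:: (i, ~~ s)])).
Qed.

Lemma bcong_mulVw n (u : bword n) : bcong (winv u ++ u) [::].
Proof. by rewrite -{2}(winvK u); exact: bcong_mulwV. Qed.

Lemma bcong_winv n (u v : bword n) : bcong u v -> bcong (winv u) (winv v).
Proof.
move=> uv; have catl w : bcong (w ++ u) (w ++ v).
  by apply: bcong_cat => //; exact: bcong_refl.
have e1 : bcong (winv u) (winv u ++ v ++ winv v).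
  rewrite -[X in bcong X _]cats0; apply: bcong_cat; first exact: bcong_refl.
  exact/bcong_sym/bcong_mulwV.
apply: bcong_trans e1 _; rewrite catA -[X in bcong _ X]cat0s.
apply: bcong_cat; last exact: bcong_refl.
exact: bcong_trans (bcong_sym (catl _)) (bcong_mulVw u).
Qed.

Section BraidGroup.
Variable n : nat.
Implicit Types x y z : braid n.

Definition bone : braid n := bclass [::].
Definition bmul x y : braid n := bclass (repr x ++ repr y).
Definition binv x : braid n := bclass (winv (repr x)).

Lemma bclass_cat (u v : bword n) : bclass (u ++ v) = bmul (bclass u) (bclass v).
Proof.
by apply/bclassP/bcong_sym; apply: bcong_cat; exact: repr_bclass.
Qed.

Lemma bclass_winv (u : bword n) : bclass (winv u) = binv (bclass u).
Proof. by apply/bclassP/bcong_sym/bcong_winv; exact: repr_bclass. Qed.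

Lemma bmulA : associative bmul.
Proof.
move=> x y z; rewrite -(bclass_repr x) -(bclass_repr y) -(bclass_repr z).
by rewrite -!bclass_cat catA.
Qed.

Lemma bmul1 : left_id bone bmul.
Proof. by move=> x; rewrite -(bclass_repr x) -bclass_cat. Qed.

Lemma bmulr1 : right_id bone bmul.
Proof. by move=> x; rewrite -(bclass_repr x) -bclass_cat cats0. Qed.

Lemma bmulV : left_inverse bone binv bmul.
Proof.
move=> x; rewrite -(bclass_repr x) -bclass_winv -bclass_cat.
by apply/bclassP; exact: bcong_mulVw.
Qed.

Lemma bmulrV : right_inverse bone binv bmul.
Proof.
move=> x; rewrite -(bclass_repr x) -bclass_winv -bclass_cat.
by apply/bclassP; exact: bcong_mulwV.
Qed.

HB.instance Definition _ :=
  isGroup.Build (braid n) bmulA bmul1 bmulr1 bmulV bmulrV.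

End BraidGroup.

Definition sigma n (i : 'I_n.-1) : braid n := bclass [:: (i, false)].

(* The homomorphism B_n -> B_{n+1} with sigma_i |-> sigma_i. *)
Definition wincl n (u : bword n) : bword n.+1 :=
  [seq (widen_ord (leq_pred n) l.1, l.2) | l <- u].
Definition bincl n (x : braid n) : braid n.+1 := bclass (wincl (repr x)).

Lemma bcong_wincl n (u v : bword n) : bcong u v -> bcong (wincl u) (wincl v).
Proof.
elim=> {u v} [u|u v _|u v w _ uv _|u u' v v' _ uu' _ vv'|i s|i j lt_ij|i j eq_ij].
- exact: bcong_refl.
- exact: bcong_sym.
- exact: bcong_trans.
- by rewrite /wincl !map_cat; exact: bcong_cat.
- exact: bcong_cancel.
- exact: bcong_far.
- exact: bcong_braid.
Qed.

Lemma bincl_bclass n (u : bword n) : bincl (bclass u) = bclass (wincl u).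
Proof. by apply/bclassP/bcong_wincl; exact: repr_bclass. Qed.

Lemma bincl1 n : bincl (1 : braid n)%g = 1%g.
Proof. exact: (bincl_bclass (n := n) [::]). Qed.

Lemma binclM n (x y : braid n) : bincl (x * y)%g = (bincl x * bincl y)%g.
Proof.
rewrite -(bclass_repr x) -(bclass_repr y) -[(_ * _)%g]bclass_cat !bincl_bclass.
by rewrite /wincl map_cat [LHS]bclass_cat.
Qed.

Local Open Scope ring_scope.

(* Homomorphisms B_n -> GL_N(F): the values are invertible since B_n is a
   group and 1 is sent to the identity matrix. *)
Record brep (F : fieldType) (n N : nat) := BRep {
  brep_fun :> braid n -> 'M[F]_N;
  brep1 : brep_fun 1%g = 1%:M;
  brepM : forall x y, brep_fun (x * y)%g = brep_fun x *m brep_fun y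
}.

Section Constructions.
Variable F : fieldType.

Fact res_rep1 n N (R : brep F n.+1 N) : R (bincl 1%g) = 1%:M.
Proof. by rewrite bincl1 brep1. Qed.
Fact res_repM n N (R : brep F n.+1 N) x y :
  R (bincl (x * y)%g) = R (bincl x) *m R (bincl y).
Proof. by rewrite binclM brepM. Qed.
Definition res_rep n N (R : brep F n.+1 N) : brep F n N :=
  BRep (res_rep1 R) (res_repM R).

Section DirectSum.
Variables (n k : nat) (d : 'I_k -> nat) (S : forall i, brep F n (d i)).
Fact dsum_rep1 : \mxdiag_(i < k) S i 1%g = 1%:M.
Proof. by rewrite -mxdiagZ; apply: eq_mxdiag => i; rewrite brep1. Qed.
Fact dsum_repM x y :
  \mxdiag_(i < k) S i (x * y)%g =
    (\mxdiag_(i < k) S i x) *m (\mxdiag_(i < k) S i y).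
Proof.
rewrite {3}/mxdiag mul_mxdiag_mxblock; apply: eq_mxblock => i j.
case: eqVneq => [eq_ij|_]; last by rewrite mulmx0.
by case: _ / eq_ij; rewrite !conform_mx_id brepM.
Qed.
Definition dsum_rep : brep F n (\sum_(i < k) d i) := BRep dsum_rep1 dsum_repM.
End DirectSum.

Section Extension.
Variables (K : fieldType) (f : {rmorphism F -> K}) (n N : nat) (R : brep F n N).
Fact ext_rep1 : map_mx f (R 1%g) = 1%:M.
Proof. by rewrite brep1 map_mx1. Qed.
Fact ext_repM x y : map_mx f (R (x * y)%g) = map_mx f (R x) *m map_mx f (R y).
Proof. by rewrite brepM map_mxM. Qed.
Definition ext_rep : brep K n N := BRep ext_rep1 ext_repM.
End Extension.

(* The invariant subspaces of row vectors are the orthogonals of the invariant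
   subspaces of column vectors, so the row convention of stablemx gives the
   usual notion. *)
Definition irreducible_rep n N (R : brep F n N) : Prop :=
  (0 < N)%N /\
  forall U : 'M[F]_N, (forall x, stablemx U (R x)) -> U = 0 \/ row_full U.

Definition iso_rep n N N' (R : brep F n N) (R' : brep F n N') : Prop :=
  exists P : 'M[F]_(N, N'),
    [/\ row_free P, row_full P & forall x, R x *m P = P *m R' x].

(* R factors through H_n(alpha), the quotient of the group algebra of B_n by
   the relations (sigma_i + 1)(sigma_i - alpha) = 0; the representations of
   H_n(alpha) are the representations of B_n that do so. *)
Definition hecke_rep (alpha : F) n N (R : brep F n N) : Prop :=
  forall i : 'I_n.-1, (R (sigma i) + 1%:M) *m (R (sigma i) - alpha%:M) = 0.

End Constructions.

Definition abs_irreducible_rep (F : fieldType) n N (R : brep F n N) : Prop :=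
  forall (K : fieldType) (f : {rmorphism F -> K}),
    irreducible_rep (ext_rep f R).

(* Partitions are weakly decreasing sequences of positive integers. *)
Definition is_partition (n : nat) (lam : seq nat) : bool :=
  [&& sorted geq lam, 0 \notin lam & sumn lam == n]%N.

Definition remove_box (lam : seq nat) (i : nat) : seq nat :=
  [seq x <- set_nth 0 lam i (nth 0 lam i).-1 | x != 0]%N.

Definition box_removals (lam : seq nat) : seq (seq nat) :=
  [seq remove_box lam i
     | i <- iota 0 (size lam) & (nth 0 lam i.+1 < nth 0 lam i)%N].

(* R is the representation associated to the partition lam of n: for n > 0, an
   irreducible representation of H_n(alpha) whose restriction to
   H_{n-1}(alpha) is the direct sum of those associated to the partitions
   obtained by removing one box, [2] and [1,1] being told apart by
   sigma_1 |-> -1 and sigma_1 |-> alpha. For n > 2 a partition is determined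
   by its box removals, so this recursion determines the labelling. *)
Fixpoint specht_rep (F : fieldType) (alpha : F) (n : nat) (lam : seq nat) :
    forall N : nat, brep F n N -> Prop :=
  match n return forall N : nat, brep F n N -> Prop with
  | 0 => fun N R => lam = [::] /\ N = 1%N
  | m.+1 => fun N R =>
      [/\ is_partition m.+1 lam,
          hecke_rep alpha R,
          irreducible_rep R,
          m.+1 = 2%N -> forall i,
            R (sigma i) = (if lam == [:: 2%N] then - 1 else alpha)%:M
        & exists (d : 'I_(size (box_removals lam)) -> nat)
                 (S : forall i, brep F m (d i)),
            (forall i : 'I_(size (box_removals lam)),
               specht_rep alpha (nth [::] (box_removals lam) i) (S i))
            /\ iso_rep (res_rep R) (dsum_rep S)]
  end.

(* The standard Hermitian form over the field with Q ^ 2 elements. *)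
Definition hermitian_form (F : fieldType) (Q N : nat) (x y : 'cV[F]_N) : F :=
  \sum_(i < N) x i 0 * y i 0 ^+ Q.

Definition inGU (F : fieldType) (Q N : nat) (M : 'M[F]_N) : Prop :=
  M \in unitmx /\
  forall x y, hermitian_form Q (M *m x) (M *m y) = hermitian_form Q x y.

(* Main.v *)
Require Import Defs.
From HB Require Import structures.
From mathcomp Require Import all_boot all_order all_algebra all_fingroup all_field.
From mathcomp Require Import all_solvable.
From mathcomp Require Import zify ring.
Import GRing.Theory.

(** Let phi be the map x |-> x ^+ Q, where Q is the order of the field generated by
    alpha + alpha^-1. It is an involution of L with phi alpha = alpha^-1, and the
    theorem asks for a form, Hermitian with respect to phi, for which every
    generator is unitary. Such a form is written down in an explicit basis.

    Restricting R to B_1, B_2, ... splits it into lines indexed by the standard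
    tableaux of shape lam. With A_k for the k-th generator, the Jucys-Murphy
    elements X_0 = 1, X_(k+1) = A_k X_k A_k act on these lines by
    alpha ^+ (k - c), c being the content of the k-th box
    ([specht_gelfand_tsetlin]). Since n < e, the eigenvalues separate the tableaux.
    As A_k commutes with X_m for m other than k and k + 1, its only nonzero
    off-diagonal entries link tableaux that differ by the exchange of the boxes k
    and k + 1. The relation X_(k+1) A_k^-1 = A_k X_k gives the diagonal entries,
    and the quadratic relation the product of the two entries of a link, which is
    not zero.

    The eigenvalues of X_n are found by induction on n. The element X_n is diagonal
    because it commutes with the lower X_k. At the ends of a link of A_(n-1) its
    eigenvalue is forced to be the expected one, and the set of vectors where this
    is the case is invariant, so irreducibility concludes. If A_(n-1) is diagonal,
    lam is a rectangle, and X_n is a scalar that the last two boxes determine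
    ([top_diag_rectangle]).

    The form is diagonal, with entries h. On the diagonal, unitarity of A_k is
    automatic, because phi inverts the eigenvalues. Off the diagonal it prescribes
    the ratio of h at the two ends of each link. Such an h exists if the ratios are
    path independent, and by a diamond lemma for the sorting of tableau words
    ([ex_potential]) it is enough to consider squares and hexagons. There, the
    products of matrix entries along the two paths are the same entry of the two
    sides of a commutation or braid relation. The ratios are fixed by phi, hence so
    is h, hence h = y * phi y for some y, and rescaling the basis by y turns the
    form into the standard one ([gt_unitary]). *)

Set Implicit Arguments.
Unset Strict Implicit.
Unset Printing Implicit Defensive.

(** * Lattice words *)

(** A standard tableau is encoded by the word whose k-th letter is the row of its
    k-th box, boxes and rows being numbered from 0. The multiplicities of the
    letters are then row lengths, and those of every prefix form a partition. *)
Definition dominant (u : seq nat) := forall r, count_mem r.+1 u <= count_mem r u.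

Definition yamanouchi (w : seq nat) := forall k, dominant (take k w).

(** k minus the content (column minus row) of the k-th box. The column is at most
    k, so the subtraction is exact. The k-th Jucys-Murphy element will act on the
    basis vector of w by alpha to this power. *)
Definition jm_exp (w : seq nat) k :=
  k + nth 0 w k - count_mem (nth 0 w k) (take k w).

Definition adj_swap k m := if m == k then k.+1 else if m == k.+1 then k else m.

Definition swap k (w : seq nat) := mkseq (fun m => nth 0 w (adj_swap k m)) (size w).

(** This follows from the possibility of adding a box in row r, and unlike the
    latter it survives the addition of boxes in other rows. *)
Definition filled_above (u : seq nat) r := forall q, q < r -> 0 < count_mem q u.

Lemma count_mem_rcons (u : seq nat) r q :
  count_mem q (rcons u r) = count_mem q u + (r == q).
Proof. by rewrite -cats1 count_cat /= addn0. Qed.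

Lemma dominant_leq u r s : dominant u -> r <= s -> count_mem s u <= count_mem r u.
Proof.
move=> pu /subnK <-; elim: (s - r) => [|d IH] //; apply: leq_trans IH; exact: pu.
Qed.

Lemma dominant_perm u v : perm_eq u v -> dominant u -> dominant v.
Proof. by move=> /seq.permP e pu r; rewrite -!e. Qed.

Lemma filled_above_rcons u r : dominant u -> dominant (rcons u r) -> filled_above u r.
Proof.
case: r => // r pu pr q; rewrite ltnS => qr.
have := pr r; rewrite !count_mem_rcons eqxx (gtn_eqF (ltnSn r)) addn0 => h.
by apply: leq_trans (dominant_leq pu qr); lia.
Qed.

(** A hook: row r and one box in each of the next d rows. *)
Lemma rows_leq_size (u : seq nat) r d :
  (forall q, r < q <= r + d -> 0 < count_mem q u) -> count_mem r u + d <= size u.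
Proof.
move=> h; apply: (@leq_trans (count (fun q => r <= q <= r + d) u)); last exact: count_size.
elim: d h => [|d IH] h.
  by rewrite addn0 eq_leq //; apply: eq_count => q /=; lia.
have := count_predUI (fun q => r <= q <= r + d) (pred1 (r + d.+1)) u.
rewrite (eq_count (a2 := fun q => r <= q <= r + d.+1)); last by move=> q /=; lia.
rewrite [X in _ + X](eq_count (a2 := pred0)); last by move=> q /=; lia.
rewrite count_pred0 addn0 => ->.
have h1 : 0 < count_mem (r + d.+1) u by apply: h; rewrite leqnn andbT addnS ltnS leq_addr.
have : count_mem r u + d <= count (fun q : nat => r <= q <= r + d) u.
  by apply: IH => q hq; apply: h; lia.
by move=> h2; rewrite addnS -addn1; exact: leq_add.
Qed.

(** The boxes that come next in rows r < s have contents count r - r and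
    count s - s: these differ, by at most size u + 1. The hook estimate gives the
    upper bound. *)
Lemma content_gap u r s : dominant u -> filled_above u s -> r < s ->
  count_mem s u + r < count_mem r u + s <= (size u).+1 + r + count_mem s u.
Proof.
move=> pu su rs; have := dominant_leq pu (ltnW rs).
have := @rows_leq_size u r (s - r.+1).
have h : forall q, r < q <= r + (s - r.+1) -> 0 < count_mem q u by move=> q hq; apply: su; lia.
move=> /(_ h); lia.
Qed.

Lemma adj_swap_out k m : (m < k) || (k.+1 < m) -> adj_swap k m = m.
Proof. by rewrite /adj_swap; case: (m =P k) => [?|?]; case: (m =P k.+1) => [?|?]; lia. Qed.

Lemma size_swap k w : size (swap k w) = size w.
Proof. by rewrite size_mkseq. Qed.

Lemma nth_swap k w m : k.+1 < size w -> nth 0 (swap k w) m = nth 0 w (adj_swap k m).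
Proof.
move=> hk; case: (ltnP m (size w)) => hm; first by rewrite nth_mkseq.
rewrite nth_default ?size_swap // nth_default //.
by rewrite adj_swap_out //; lia.
Qed.

Lemma take_swap_lt k w m : m <= k -> k.+1 < size w -> take m (swap k w) = take m w.
Proof.
move=> mk hk; apply: (@eq_from_nth _ 0); rewrite !size_take size_swap // => i.
rewrite ifT; last by lia.
move=> im; rewrite !nth_take //.
by rewrite nth_swap // adj_swap_out //; lia.
Qed.

Lemma take_rcons k (w : seq nat) : k < size w -> take k.+1 w = rcons (take k w) (nth 0 w k).
Proof. by move=> hk; rewrite (take_nth 0). Qed.

Lemma take_swap1 k w : k.+1 < size w ->
  take k.+1 (swap k w) = rcons (take k w) (nth 0 w k.+1).
Proof.
move=> hk; rewrite take_rcons ?size_swap 1?ltnW // take_swap_lt // nth_swap //.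
by rewrite /adj_swap eqxx.
Qed.

Lemma take_swap2 k w m : k.+1 < m -> k.+1 < size w ->
  perm_eq (take m (swap k w)) (take m w).
Proof.
move=> km hk.
have e2 : perm_eq (take k.+2 (swap k w)) (take k.+2 w).
  rewrite take_rcons ?size_swap // take_swap1 // nth_swap // /adj_swap eqxx gtn_eqF //.
  rewrite take_rcons // take_rcons 1?ltnW // -!cats1 -!catA perm_cat2l /=.
  by apply/seq.permP => p /=; lia.
rewrite -(subnKC km); elim: (m - k.+2) => [|d IH]; first by rewrite addn0.
rewrite addnS; case: (ltnP (k.+2 + d) (size w)) => hd; last first.
  by move: IH; rewrite !(@take_oversize _ (_ + _)) ?(@take_oversize _ (_ + _).+1) ?size_swap // ltnW.
rewrite !(@take_rcons (k.+2 + d)) ?size_swap // nth_swap // [adj_swap k _]adj_swap_out; last by lia.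
by rewrite -!cats1 perm_cat2r.
Qed.

Lemma perm_swap k w : k.+1 < size w -> perm_eq (swap k w) w.
Proof.
move=> hk; have := @take_swap2 k w (size w) hk hk.
by rewrite take_size take_oversize // size_swap.
Qed.

(** A box of row r can only make room for a box in the row below it. *)
Lemma dominant_up u r s : dominant u -> dominant (rcons (rcons u r) s) ->
  r.+1 != s -> dominant (rcons u s).
Proof.
move=> pu prs rs q; have := pu q; have := prs q; rewrite !count_mem_rcons.
by case: (s =P q.+1) => [?|]; case: (r =P q) => /= *; lia.
Qed.

(** The prefix of length k + 1 is the only one whose multiplicities change. *)
Lemma yam_swap k w : k.+1 < size w -> yamanouchi w ->
  dominant (rcons (take k w) (nth 0 w k.+1)) -> yamanouchi (swap k w).
Proof.
move=> hk yw pk m; case: (ltngtP m k.+1) => hm.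
- by rewrite take_swap_lt //; exact: yw.
- by apply: dominant_perm (yw m); rewrite perm_sym take_swap2.
- by rewrite hm take_swap1.
Qed.

(** The later box lies in a higher row, so the earlier one did not make room for
    it. Hence sorting a word by exchanging descents stays among the tableaux, and
    no shape has to be examined in the diamond lemma below. *)
Lemma yam_swap_descent k w : k.+1 < size w -> yamanouchi w ->
  nth 0 w k.+1 < nth 0 w k -> yamanouchi (swap k w).
Proof.
move=> hk yw lt; apply: yam_swap => //.
apply: (@dominant_up _ (nth 0 w k)); first exact: yw.
  by rewrite -take_rcons 1?ltnW // -take_rcons //; exact: (yw k.+2).
by rewrite gtn_eqF // ltnS ltnW.
Qed.

Lemma jm_exp_perm w w' k : perm_eq (take k w) (take k w') -> nth 0 w k = nth 0 w' k ->
  jm_exp w k = jm_exp w' k.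
Proof. by move=> /seq.permP e1 e2; rewrite /jm_exp e1 e2. Qed.

Lemma yam_filled w k : k < size w -> yamanouchi w -> filled_above (take k w) (nth 0 w k).
Proof. by move=> hk yw; apply: filled_above_rcons (yw k) _; rewrite -take_rcons. Qed.

Lemma yam_head w : yamanouchi w -> nth 0 w 0 = 0.
Proof.
case: w => // r w yw; case: r yw => // r yw.
by have := yw 1 r; rewrite /= take0 /= eqxx; case: eqP; lia.
Qed.

Lemma yam_rcons v r : yamanouchi v -> dominant (rcons v r) -> yamanouchi (rcons v r).
Proof.
move=> yv pr k; case: (leqP k (size v)) => hk; first by rewrite -cats1 takel_cat.
by rewrite take_oversize // size_rcons.
Qed.

Lemma removable_mem q u : count_mem q.+1 u < count_mem q u -> q \in u.
Proof. by move=> h; rewrite -has_pred1 has_count; lia. Qed.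

Lemma dominant_rem u q : dominant u -> count_mem q.+1 u < count_mem q u -> dominant (rem q u).
Proof.
move=> pu hq r; have := pu r; rewrite !count_rem (removable_mem hq) /=.
have [E|_] := eqVneq q r; last by move=> h; rewrite subn0 (leq_trans (leq_subr _ _) h).
by rewrite -E (ltn_eqF (ltnSn q)) subn0 => _; rewrite -ltnS subn1 prednK //; exact: leq_trans hq.
Qed.

Lemma ex_max_row (u : seq nat) : 0 < size u ->
  exists2 q, q \in u & forall r, q < r -> count_mem r u = 0.
Proof.
elim: u => [//|x u IH] _; case: (posnP (size u)) => [/size0nil -> | /IH [q qu hq]].
  by exists x; rewrite ?mem_head // => r xr; rewrite /= ltn_eqF.
case: (leqP x q) => xq.
  by exists q => [|r qr]; rewrite ?in_cons ?qu ?orbT //= hq // ltn_eqF //; lia.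
exists x => [|r xr]; rewrite ?mem_head //= hq ?ltn_eqF //; lia.
Qed.

(** The last box can be taken from the lowest nonempty row. *)
Lemma ex_yam u : dominant u -> exists2 v, perm_eq v u & yamanouchi v.
Proof.
elim: {u}(size u) {-2}u (erefl (size u)) => [|m IH] u su pu.
  by rewrite (size0nil su); exists [::].
have [q qu hq] : exists2 q, q \in u & forall r, q < r -> count_mem r u = 0.
  by apply: ex_max_row; rewrite su.
have cq : count_mem q.+1 u < count_mem q u by rewrite hq // -has_count has_pred1.
have [v pv yv] := IH (rem q u) ltac:(by rewrite size_rem // su) (dominant_rem pu cq).
have pe : perm_eq (rcons v q) u.
  by rewrite perm_rcons perm_sym (permPl (perm_to_rem qu)) perm_cons perm_sym.
by exists (rcons v q) => //; apply: yam_rcons => //; apply: dominant_perm pu; rewrite perm_sym.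
Qed.

Lemma ex_yam_removable u q : dominant u -> count_mem q.+1 u < count_mem q u ->
  exists2 v, perm_eq (rcons v q) u & yamanouchi v.
Proof.
move=> pu hq; have [v pv yv] := ex_yam (dominant_rem pu hq); exists v => //.
rewrite perm_rcons perm_sym (permPl (perm_to_rem (removable_mem hq))).
by rewrite perm_cons perm_sym.
Qed.

Lemma count2_leq_size (a b : nat) (s : seq nat) : a != b ->
  count_mem a s + count_mem b s <= size s.
Proof.
move=> ab; rewrite -(count_predC (pred1 a) s) leq_add2l.
by apply: sub_count => x /= /eqP->; rewrite eq_sym.
Qed.

(** All rows above the new box are filled, and no row has two boxes. *)
Lemma column_word w k : yamanouchi w -> (forall q, count_mem q w <= 1) -> k < size w ->
  nth 0 w k = k.
Proof.
move=> yw h; elim/ltn_ind: k => k IH kw.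
have tk : take k w = iota 0 k.
  apply: (@eq_from_nth _ 0); first by rewrite size_iota size_takel // ltnW.
  rewrite size_takel; last exact: ltnW.
  by move=> i ik; rewrite nth_take // nth_iota // add0n IH // (ltn_trans ik).
have sp := yam_filled kw yw.
case: (ltngtP (nth 0 w k) k) => // lt.
  have := h (nth 0 w k); rewrite -{2}(cat_take_drop k.+1 w) count_cat take_rcons //.
  rewrite count_mem_rcons eqxx tk.
  have : 0 < count_mem (nth 0 w k) (iota 0 k).
    by rewrite -has_count has_pred1 mem_iota.
  by lia.
by have := sp k lt; rewrite tk -has_count has_pred1 mem_iota add0n ltnn andbF.
Qed.

Lemma row_word w k : (forall q, 0 < q -> count_mem q w = 0) -> nth 0 w k = 0.
Proof.
move=> h; case: (ltnP k (size w)) => kw; last exact: nth_default.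
case: (posnP (nth 0 w k)) => // /h /eqP; rewrite -leqn0 leqNgt -has_count has_pred1.
by rewrite mem_nth.
Qed.

Lemma adj_swap_l k : adj_swap k k = k.+1. Proof. by rewrite /adj_swap eqxx. Qed.
Lemma adj_swap_r k : adj_swap k k.+1 = k. Proof. by rewrite /adj_swap eqxx gtn_eqF. Qed.

Lemma adj_swapK k : involutive (adj_swap k).
Proof.
move=> m; case: (ltngtP m k) => [mk|mk|->]; last by rewrite adj_swap_l adj_swap_r.
  by rewrite !adj_swap_out ?mk.
case: (ltngtP m k.+1) => [|mk1|->]; [lia | | by rewrite adj_swap_r adj_swap_l].
by rewrite !adj_swap_out ?mk1 ?orbT.
Qed.

Lemma adj_swap_far j k m : j.+1 < k -> adj_swap k (adj_swap j m) = adj_swap j (adj_swap k m).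
Proof.
move=> jk; have [mj|mj] := leqP m j.+1.
  have := mj; rewrite leq_eqVlt ltnS leq_eqVlt => /or3P[/eqP->|/eqP->|lt].
  - by rewrite (@adj_swap_out k j.+1) ?jk // adj_swap_r adj_swap_out //; lia.
  - by rewrite (@adj_swap_out k j) ?adj_swap_l ?adj_swap_out ?jk //; lia.
  - by rewrite !(@adj_swap_out _ m) //; lia.
rewrite (@adj_swap_out j m) ?mj ?orbT // [RHS]adj_swap_out //; apply/orP; right.
case: (ltngtP m k) => [mk|mk|->]; [by rewrite adj_swap_out ?mk| |by rewrite adj_swap_l; lia].
case: (ltngtP m k.+1) => [|mk1|->]; [lia | by rewrite adj_swap_out ?mk1 ?orbT | by rewrite adj_swap_r].
Qed.

Lemma adj_swap_braid k m :
  adj_swap k (adj_swap k.+1 (adj_swap k m)) =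
  adj_swap k.+1 (adj_swap k (adj_swap k.+1 m)).
Proof.
case: (ltngtP m k) => [mk|mk|->].
- by rewrite !(@adj_swap_out _ m) //; lia.
- have [lt|] := ltnP k.+2 m; first by rewrite !(@adj_swap_out _ m) //; lia.
  rewrite leq_eqVlt ltnS => /orP[/eqP->|mk1].
    by rewrite (@adj_swap_out k k.+2) ?adj_swap_r ?(@adj_swap_out k.+1 k) ?ltnSn ?orbT //
         ?adj_swap_r; lia.
  have -> : m = k.+1 by lia.
  rewrite adj_swap_r (@adj_swap_out k.+1 k) ?ltnSn // !adj_swap_l.
  by rewrite (@adj_swap_out k k.+2) ?adj_swap_r //; lia.
- by rewrite !adj_swap_l (@adj_swap_out k k.+2) ?(@adj_swap_out k.+1 k) ?adj_swap_l //; lia.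
Qed.

Lemma swapK k w : k.+1 < size w -> swap k (swap k w) = w.
Proof.
move=> hk; apply: (@eq_from_nth _ 0) => [|m _]; first by rewrite !size_swap.
by rewrite !nth_swap ?size_swap // adj_swapK.
Qed.

Lemma swap_far j k w : j.+1 < k -> k.+1 < size w -> swap k (swap j w) = swap j (swap k w).
Proof.
move=> jk hk; have hj : j.+1 < size w by lia.
apply: (@eq_from_nth _ 0) => [|m _]; first by rewrite !size_swap.
by rewrite !nth_swap ?size_swap // (adj_swap_far m jk).
Qed.

Lemma swap_braid k w : k.+2 < size w ->
  swap k (swap k.+1 (swap k w)) = swap k.+1 (swap k (swap k.+1 w)).
Proof.
move=> hk; have hk1 := ltnW hk.
apply: (@eq_from_nth _ 0) => [|m _]; first by rewrite !size_swap.
by rewrite !nth_swap ?size_swap // adj_swap_braid.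
Qed.

(** Exchanging a descent lowers the sum of one prefix and keeps the others, so
    this statistic measures the progress of sorting. *)
Definition word_rank (w : seq nat) := \sum_(m < (size w).+1) sumn (take m w).

Lemma word_rank_swap k w : k.+1 < size w -> nth 0 w k.+1 < nth 0 w k ->
  word_rank (swap k w) < word_rank w.
Proof.
move=> hk lt; rewrite /word_rank size_swap.
have hk1 : k.+1 < (size w).+1 by exact: ltnW.
rewrite (bigD1 (Ordinal hk1)) //= [X in _ < X](bigD1 (Ordinal hk1)) //=.
rewrite take_swap1 // (take_rcons (ltnW hk)) -!cats1 !sumn_cat /= !addn0.
rewrite (eq_bigr (fun m : 'I_(size w).+1 => sumn (take m w))) => [|m mk].
  by rewrite ltn_add2r ltn_add2l.
have {}mk : (m : nat) != k.+1 by [].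
apply: perm_sumn; case: (ltngtP m k.+1) mk => // mk _; first by rewrite take_swap_lt.
exact: take_swap2.
Qed.

Definition tableau n lam (w : seq nat) :=
  [/\ size w = n, yamanouchi w & forall r, count_mem r w = nth 0 lam r].

Lemma tableau_perm n lam w w' : tableau n lam w -> tableau n lam w' -> perm_eq w w'.
Proof.
by move=> [_ _ h] [_ _ h']; apply/allP => x _ /=; rewrite h h' eqxx.
Qed.

Lemma yam_take w k : yamanouchi w -> yamanouchi (take k w).
Proof.
move=> yw m; case: (leqP m k) => mk; first by rewrite take_takel.
by rewrite take_oversize // size_take; case: ltnP => h; lia.
Qed.

Lemma jm_exp_take w k m : m < k -> jm_exp (take k w) m = jm_exp w m.
Proof. by move=> mk; rewrite /jm_exp nth_take // take_takel // ltnW. Qed.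

Lemma perm_last n w w' : size w = n.+1 -> size w' = n.+1 -> perm_eq w w' ->
  perm_eq (take n w) (take n w') -> nth 0 w n = nth 0 w' n.
Proof.
move=> sw sw' /seq.permP pw /seq.permP pt; have := pw (pred1 (nth 0 w n)).
rewrite -(take_size w) -(take_size w') sw sw' !(@take_rcons n) ?sw ?sw' // !count_mem_rcons.
rewrite !nth_rcons !size_takel ?sw ?sw' // ltnn !eqxx pt => /addnI /esym/eqP.
by rewrite eqb1 => /eqP ->.
Qed.

(** * Removing boxes *)

Definition removable_rows (lam : seq nat) :=
  [seq i <- iota 0 (size lam) | nth 0 lam i.+1 < nth 0 lam i].

Lemma geq_trans : transitive geq.
Proof. by move=> x y z /= xy yz; exact: leq_trans yz xy. Qed.

(** The zeros of a weakly decreasing sequence come last. *)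
Lemma nth_filter_pos s q : sorted geq s -> nth 0 [seq x <- s | x != 0] q = nth 0 s q.
Proof.
elim: s q => [//|x s IH] q /= ps; have [x0|x0] /= := eqVneq x 0; last first.
  by case: q => //= q; apply/IH/path_sorted/ps.
have s0 : forall y, y \in s -> y = 0.
  have := order_path_min geq_trans ps => /allP h y ys; have := h y ys; rewrite /= x0 leqn0.
  by move/eqP.
have -> : [seq x <- s | x != 0] = [::].
  by apply/eqP; rewrite -[_ == _]negbK -has_filter; apply/hasPn => y /s0 ->.
case: q => [|q] /=; first by rewrite x0.
case: (ltnP q (size s)) => h.
  by rewrite (s0 (nth 0 s q)) ?mem_nth.
by rewrite nth_default.
Qed.

Lemma partition_nth_leq n lam q : is_partition n lam -> nth 0 lam q.+1 <= nth 0 lam q.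
Proof.
case/and3P => /(sortedP 0) h _ _; case: (ltnP q.+1 (size lam)) => ql; first exact: h.
by rewrite nth_default.
Qed.

Lemma nth_remove_box n lam r q : is_partition n lam -> r \in removable_rows lam ->
  nth 0 (remove_box lam r) q = nth 0 lam q - (q == r).
Proof.
move=> pl; rewrite mem_filter mem_iota add0n => /andP[lt rl].
rewrite nth_filter_pos.
  by rewrite nth_set_nth /=; have [->|_] := eqVneq q r; rewrite ?subn1 ?subn0.
apply/(sortedP 0) => i _; rewrite !nth_set_nth /=; have := partition_nth_leq i pl.
have [->|ir] := eqVneq i r.
  by rewrite gtn_eqF // => _; rewrite -ltnS prednK //; exact: leq_ltn_trans lt.
have [->|_] := eqVneq i.+1 r => // h; apply: leq_trans h; exact: leq_pred.
Qed.

Lemma tableau_rcons n lam r w : is_partition n.+1 lam -> r \in removable_rows lam ->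
  tableau n (remove_box lam r) w -> tableau n.+1 lam (rcons w r).
Proof.
move=> pl rr [sw yw cw].
have c q : count_mem q (rcons w r) = nth 0 lam q.
  rewrite count_mem_rcons cw (nth_remove_box _ pl rr) eq_sym subnK //.
  move: rr; rewrite mem_filter mem_iota => /andP[lt _]; have [->|//] := eqVneq q r.
  exact: leq_ltn_trans lt.
split=> //; first by rewrite size_rcons sw.
by apply: yam_rcons => // q; rewrite !c; exact: partition_nth_leq pl.
Qed.

Lemma tableau_inv n lam w : is_partition n.+1 lam -> tableau n.+1 lam w ->
  exists r w', [/\ r \in removable_rows lam, w = rcons w' r & tableau n (remove_box lam r) w'].
Proof.
move=> pl []; case/lastP: w => [//|w r]; rewrite size_rcons => -[sw] yw cw.
have c q := cw q.
have pw : dominant w by have := yw n; rewrite -cats1 take_cat sw ltnn subnn take0 cats0.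
have rr : r \in removable_rows lam.
  rewrite mem_filter mem_iota add0n -!c !count_mem_rcons eqxx (ltn_eqF (ltnSn r)) addn0.
  rewrite addn1 ltnS pw /=; have [//|h] := ltnP r (size lam).
  by have := c r; rewrite count_mem_rcons eqxx nth_default // addn1.
exists r, w; split=> //; split=> //.
  by have := yam_take n yw; rewrite -cats1 take_cat sw ltnn subnn take0 cats0.
by move=> q; rewrite (nth_remove_box _ pl rr) -c count_mem_rcons eq_sym addnK.
Qed.

(** * Jucys-Murphy eigenvalues determine words *)

Section Weights.
Local Open Scope ring_scope.
Variables (F : fieldType) (alpha : F) (e : nat).
Hypothesis prim : e.-primitive_root alpha.

Lemma expr_inj_lt a b : alpha ^+ a = alpha ^+ b -> (a < b + e)%N -> (b < a + e)%N ->
  a = b.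
Proof.
move=> /eqP; rewrite (eq_prim_root_expr prim).
wlog ab : a b / (a <= b)%N => [hw|].
  case: (leqP a b) => ab; first exact: hw.
  by move=> h h1 h2; apply/esym/hw => //; [exact: ltnW | rewrite eq_sym].
rewrite eq_sym eqn_mod_dvd // => dv _ lt.
case: (posnP (b - a)) => [|pos]; first by lia.
by have := dvdn_leq pos dv; lia.
Qed.

(** The contents in question lie in an interval shorter than the order of alpha. *)
Lemma letter_inj u r s :
  dominant u -> filled_above u r -> filled_above u s -> ((size u).+1 < e)%N ->
  alpha ^+ (size u + r - count_mem r u) = alpha ^+ (size u + s - count_mem s u) ->
  r = s.
Proof.
move=> pu; have cr q : (count_mem q u <= size u)%N by exact: count_size.
wlog: r s / (r <= s)%N => [hw|].
  move=> ur us lt h; case: (leqP r s) => rs; first exact: hw.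
  by apply/esym/hw => //; exact: ltnW.
rewrite leq_eqVlt => /orP[/eqP //|rs] ur us lt /expr_inj_lt h.
have := content_gap pu us rs; have := cr r; have := cr s; lia.
Qed.

Section TwoWords.
Variables (n : nat) (w w' : seq nat).
Hypotheses (ne : (n < e)%N) (sw : size w = n) (sw' : size w' = n).
Hypotheses (yw : yamanouchi w) (yw' : yamanouchi w').

Lemma next_letter m : (m < n)%N -> perm_eq (take m w) (take m w') ->
  alpha ^+ jm_exp w m = alpha ^+ jm_exp w' m -> nth 0%N w m = nth 0%N w' m.
Proof.
move=> mn pe h; have sz : size (take m w) = m by rewrite size_takel // sw ltnW.
apply: (@letter_inj (take m w)).
- exact: yw.
- by apply: yam_filled => //; rewrite sw.
- move=> q qs; have := @yam_filled w' m; rewrite sw' => /(_ mn yw' q qs).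
  by move/seq.permP: pe => ->.
- by rewrite sz; lia.
- by move: h; rewrite /jm_exp sz; have /seq.permP e1 := pe; rewrite !e1.
Qed.

Lemma prefix_eq k : (k <= n)%N ->
  (forall m, (m < k)%N -> alpha ^+ jm_exp w m = alpha ^+ jm_exp w' m) -> take k w = take k w'.
Proof.
elim: k => [|k IH] kn h; first by rewrite !take0.
have ek : take k w = take k w' by apply: (IH (ltnW kn)) => m mk; apply: h; exact: ltnW.
rewrite !take_rcons ?sw ?sw' // ek; congr rcons; apply: next_letter => //.
  by rewrite ek.
exact: h.
Qed.

Lemma suffix_eq k : perm_eq (take k w) (take k w') ->
  (forall m, (k <= m < n)%N -> alpha ^+ jm_exp w m = alpha ^+ jm_exp w' m) ->
  forall m, (k <= m < n)%N -> nth 0%N w m = nth 0%N w' m.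
Proof.
move=> pe h m /andP[km]; rewrite -(subnKC km); move: (m - k)%N => d {m km}.
have pd : (k + d < n)%N -> perm_eq (take (k + d) w) (take (k + d) w').
  elim: d => [|d IH] kd; first by rewrite addn0.
  rewrite addnS !(@take_rcons (k + d)) ?sw ?sw'; try by lia.
  have pp := IH ltac:(lia).
  rewrite (@next_letter (k + d)) //; try by lia.
    by rewrite -!cats1 perm_cat2r.
  by apply: h; lia.
by move=> kd; apply: next_letter => //; [exact: pd | apply: h; lia].
Qed.

(** The box that w' adds to the common prefix keeps its content when it is added
    after the k-th box of w, which lies in another row. So the hypothesis compares
    the contents of two boxes that can be added to one and the same shape. *)
Lemma swap_letters k : (k.+1 < n)%N -> take k w = take k w' ->
  nth 0%N w k != nth 0%N w' k ->
  alpha ^+ jm_exp w k.+1 = alpha * alpha ^+ jm_exp w' k -> nth 0%N w k.+1 = nth 0%N w' k.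
Proof.
move=> kn ek neq h.
have sz : size (take k.+1 w) = k.+1 by rewrite size_takel // sw ltnW.
have er : take k.+1 w = rcons (take k w) (nth 0%N w k) by rewrite take_rcons // sw ltnW.
have sz0 : size (take k w) = k by rewrite size_takel // sw; lia.
apply: (@letter_inj (take k.+1 w)).
- exact: yw.
- by apply: yam_filled => //; rewrite sw.
- move=> q qs; rewrite er count_mem_rcons; apply: ltn_addr; rewrite ek.
  by apply: (@yam_filled w' k) qs => //; rewrite sw'; lia.
- by rewrite sz; lia.
- move: h; rewrite -exprS /jm_exp sz => ->; congr (_ ^+ _).
  rewrite er count_mem_rcons (negbTE neq) addn0 ek addSn subSn //.
  have := count_size (pred1 (nth 0%N w' k)) (take k w').
  by rewrite -ek sz0; lia.
Qed.
End TwoWords.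

(** The hypotheses are what a nonzero off-diagonal entry of the k-th generator
    imposes on the Jucys-Murphy eigenvalues of the two basis vectors it links. *)
Lemma swapped_word n w w' k :
  (n < e)%N -> size w = n -> size w' = n -> yamanouchi w -> yamanouchi w' ->
  (k.+1 < n)%N ->
  (forall m, (m < n)%N -> m != k -> m != k.+1 -> alpha ^+ jm_exp w m = alpha ^+ jm_exp w' m) ->
  alpha ^+ jm_exp w k.+1 = alpha * alpha ^+ jm_exp w' k ->
  alpha ^+ jm_exp w' k.+1 = alpha * alpha ^+ jm_exp w k ->
  w' = w \/ w' = swap k w /\ nth 0%N w k != nth 0%N w k.+1.
Proof.
move=> ne sw sw' yw yw' kn h h1 h2.
have ek : take k w = take k w'.
  by apply: (@prefix_eq n) => // [|m mk]; first lia; apply: h; lia.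
have [eqk|neq] := eqVneq (nth 0%N w k) (nth 0%N w' k); [left | right].
  have ek1 : take k.+1 w = take k.+1 w' by rewrite !(@take_rcons k) ?sw ?sw' 1?ltnW // ek eqk.
  have wk : jm_exp w k = jm_exp w' k by apply: jm_exp_perm; rewrite ?ek.
  apply/esym; rewrite -(take_size w) -(take_size w') sw sw'.
  apply: (@prefix_eq n) => // m mn; have [->|mk] := eqVneq m k; first by rewrite wk.
  by have [->|mk1] := eqVneq m k.+1; [rewrite h1 h2 wk | exact: h].
have e1 : nth 0%N w k.+1 = nth 0%N w' k by apply: (@swap_letters n).
have e2 : nth 0%N w' k.+1 = nth 0%N w k.
  by apply: (@swap_letters n) => //; rewrite eq_sym.
split; last by rewrite e1.
have hk : (k.+1 < size w)%N by rewrite sw.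
have pe : perm_eq (take k.+2 w) (take k.+2 w').
  rewrite !(@take_rcons k.+1) ?sw ?sw' // !(@take_rcons k) ?sw ?sw' 1?ltnW //.
  rewrite e1 e2 ek -!cats1 -!catA perm_cat2l /=; apply/seq.permP => p /=; lia.
have E := @suffix_eq n w w' ne sw sw' yw yw' k.+2 pe.
apply: (@eq_from_nth _ 0%N) => [|m]; first by rewrite size_swap sw sw'.
rewrite sw' => mn; rewrite nth_swap //.
case: (ltngtP m k) => [mk|mk|->].
- by rewrite adj_swap_out ?mk // -(@nth_take k) // -ek nth_take.
- case: (ltngtP m k.+1) => [|mk1|->]; first by lia.
  + rewrite adj_swap_out ?mk1 ?orbT //; apply/esym/E; last by lia.
    by move=> l /andP[kl ln]; apply: h => //; lia.
  + by rewrite /adj_swap eqxx gtn_eqF.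
- by rewrite /adj_swap eqxx.
Qed.

End Weights.

(** * Jucys-Murphy elements *)

Section JM.
Variable S : pzRingType.
Implicit Type A : nat -> S.
Local Open Scope ring_scope.

(** The Jucys-Murphy elements, without the usual normalisation by alpha ^- k. *)
Fixpoint jm A k : S := if k is k'.+1 then A k' * jm A k' * A k' else 1.

Definition braid_seq n A :=
  (forall i j, (i.+1 < j)%N -> (j.+1 < n)%N -> A i * A j = A j * A i) /\
  (forall i, (i.+2 < n)%N -> A i * A i.+1 * A i = A i.+1 * A i * A i.+1).

Variables (n : nat) (A : nat -> S).
Hypothesis br : braid_seq n A.

Lemma jm_comm_lt k m : (m < k)%N -> (k.+1 < n)%N -> A k * jm A m = jm A m * A k.
Proof.
move=> mk kn; elim: m mk => [|m IH] mk /=; first by rewrite mulr1 mul1r.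
have c : A k * A m = A m * A k by apply/esym/(proj1 br).
by rewrite !mulrA c -(mulrA (A m)) IH 1?ltnW // -!mulrA c.
Qed.

Lemma jm_comm_gt k m : (k.+1 < m)%N -> (m < n)%N -> A k * jm A m = jm A m * A k.
Proof.
elim: m => [//|m IH]; rewrite ltnS leq_eqVlt => /orP[/eqP<-|km] mn.
  have b := proj2 br k mn; have c := @jm_comm_lt k.+1 k (ltnSn k) mn.
  rewrite /= !mulrA b -(mulrA _ (A k.+1)) c.
  rewrite -!mulrA; congr (_ * (_ * (_ * _))).
  by rewrite !mulrA b.
have c : A k * A m = A m * A k by apply: (proj1 br).
by rewrite /= !mulrA c -(mulrA (A m)) (IH km (ltnW mn)) -!mulrA c.
Qed.

Lemma jm_commute m k : (k < n)%N -> (m < k)%N -> jm A k * jm A m = jm A m * jm A k.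
Proof.
move=> kn; elim: m => [|m IH] mk; first by rewrite /= mulr1 mul1r.
have c := jm_comm_gt mk kn.
by rewrite /= !mulrA -c -(mulrA (A m)) IH 1?ltnW // -!mulrA c.
Qed.

End JM.

Lemma eq_jm (S : pzRingType) (A B : nat -> S) k :
  (forall j, j < k -> A j = B j) -> jm A k = jm B k.
Proof.
elim: k => [//|k IH] h /=; rewrite h // IH // => j jk; apply: h; exact: ltnW.
Qed.

(** * Entries of the generators in a Jucys-Murphy eigenbasis *)

Section Eigenbasis.
Local Open Scope ring_scope.
Variables (F : fieldType) (alpha : F) (e : nat).
Hypothesis prim : e.-primitive_root alpha.

Lemma mul_entry N (A B : 'M[F]_N) i j : (A * B) i j = \sum_k A i k * B k j.
Proof. by rewrite -mulmxE mxE. Qed.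

Definition diagf N (f : 'I_N -> F) : 'M[F]_N := diag_mx (\row_i f i).

Lemma mul_diagf N (f : 'I_N -> F) A i j : (diagf f * A) i j = f i * A i j.
Proof. by rewrite -mulmxE mul_diag_mx !mxE. Qed.

Lemma mulf_diag N (f : 'I_N -> F) A i j : (A * diagf f) i j = A i j * f j.
Proof. by rewrite -mulmxE mul_mx_diag !mxE. Qed.

Lemma diagfE N (f : 'I_N -> F) i j : diagf f i j = f i *+ (i == j).
Proof. by rewrite !mxE. Qed.

Lemma lincombE N (a b : F) (A B : 'M[F]_N) i j :
  (a *: A + b *: B) i j = a * A i j + b * B i j.
Proof. by rewrite !mxE. Qed.

Lemma comm_diagf N (f : 'I_N -> F) A i j :
  A * diagf f = diagf f * A -> A i j != 0 -> f i = f j.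
Proof.
move=> /matrixP/(_ i j); rewrite mul_diagf mulf_diag mulrC => h nz.
by apply/esym/(mulIf nz).
Qed.

Definition hecke_seq n N (A : nat -> 'M[F]_N) :=
  braid_seq n A /\
  forall i, (i.+1 < n)%N -> (A i + 1) * (A i - alpha%:M) = 0.

Lemma prim_root_neq0 : alpha != 0.
Proof.
apply: contra_eq_neq (prim_expr_order prim) => ->.
by rewrite expr0n gtn_eqF ?(prim_order_gt0 prim) // eq_sym oner_eq0.
Qed.

Lemma hecke_sqr n N (A : nat -> 'M[F]_N) k : hecke_seq n A -> (k.+1 < n)%N ->
  A k * A k = (alpha - 1) *: A k + alpha%:M.
Proof.
move=> [_ h] kn; have := h k kn.
rewrite mulrDl mul1r mulrBr -mulmxE mul_mx_scalar => /eqP.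
rewrite addrA subr_eq0 => /eqP E; rewrite scalerBl scale1r -E.
by rewrite addrACA addNr addr0 addrC subrK.
Qed.

Section Entries.
Variables (n N : nat) (A : nat -> 'M[F]_N).
Hypothesis hA : hecke_seq n A.
Variables (k : nat) (x y : 'I_N -> F).
Hypotheses (kn : (k.+1 < n)%N) (dx : jm A k = diagf x) (dy : jm A k.+1 = diagf y).

(** This is X_(k+1) A_k^-1 = A_k X_k, the inverse being expressed through the
    quadratic relation. *)
Lemma hecke_inv_mul : jm A k.+1 * A k = (alpha - 1) *: jm A k.+1 + alpha *: (A k * jm A k).
Proof.
rewrite /= -mulrA (hecke_sqr hA kn) mulrDr -mulmxE -scalemxAr mul_mx_scalar.
by rewrite !mulmxE.
Qed.

Lemma hecke_mul_inv : A k * jm A k.+1 = (alpha - 1) *: jm A k.+1 + alpha *: (jm A k * A k).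
Proof.
rewrite /= !mulrA (hecke_sqr hA kn) !mulrDl -mulmxE -!scalemxAl mul_scalar_mx.
by rewrite -scalemxAl.
Qed.

Lemma jm_offdiag i j : i != j -> A k i j != 0 -> y i = alpha * x j /\ y j = alpha * x i.
Proof.
move=> ij nz; have /matrixP/(_ i j) := hecke_inv_mul; have /matrixP/(_ i j) := hecke_mul_inv.
rewrite dx dy !lincombE !mulf_diag !mul_diagf diagfE (negbTE ij) mulr0n.
rewrite !mulr0 !add0r => h1 h2; split; apply: (mulIf nz).
  by rewrite h2; ring.
by rewrite mulrC h1; ring.
Qed.

(** The eigenvalues x, y determine the diagonal entry: solving for it gives
    (alpha - 1) / (1 - alpha x / y). *)
Lemma jm_diag i : y i * (A k i i - (alpha - 1)) = alpha * A k i i * x i.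
Proof.
have /matrixP/(_ i i) := hecke_inv_mul.
rewrite dx dy lincombE mul_diagf mulf_diag diagfE eqxx mulr1n => h.
by rewrite mulrBr h; ring.
Qed.
End Entries.


Section Edges.
Variables (n N : nat) (A : nat -> 'M[F]_N) (t : 'I_N -> seq nat).
Hypothesis ne : (n < e)%N.
Hypothesis hA : hecke_seq n A.
Hypothesis t_size : forall i, size (t i) = n.
Hypothesis t_yam : forall i, yamanouchi (t i).
Hypothesis t_jm : forall k, (k < n)%N -> jm A k = diagf (fun i => alpha ^+ jm_exp (t i) k).

(** A k commutes with every Jucys-Murphy element but the k-th and the next one,
    and these two are related by jm_offdiag; the eigenvalues then determine the
    word up to an exchange. *)
Lemma offdiag_word k i j : (k.+1 < n)%N -> i != j -> A k i j != 0 ->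
  t j = t i \/ t j = swap k (t i) /\ nth 0%N (t i) k != nth 0%N (t i) k.+1.
Proof.
move=> kn ij nz; have kn' := ltnW kn.
have [h1 h2] := jm_offdiag hA kn (t_jm kn') (t_jm kn) ij nz.
apply: (@swapped_word _ _ _ prim n) => // m mn mk mk1.
apply: (@comm_diagf _ (fun i => alpha ^+ jm_exp (t i) m) (A k)) nz.
rewrite -t_jm //; case: (ltnP m k) => [lt|ge].
  exact: (jm_comm_lt (proj1 hA)).
by apply: (jm_comm_gt (proj1 hA)) => //; lia.
Qed.
End Edges.

End Eigenbasis.

(** * The eigenvalues of the last Jucys-Murphy element *)

Section Step.
Local Open Scope ring_scope.
Variables (F : fieldType) (alpha : F) (e : nat).
Hypothesis prim : e.-primitive_root alpha.

Lemma hecke_seqW n n' N (A : nat -> 'M[F]_N) : (n' <= n)%N ->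
  hecke_seq alpha n A -> hecke_seq alpha n' A.
Proof.
move=> le [[h1 h2] h3]; split; [split=> [i j ij jn | i i_n] | move=> i i_n].
- by apply: h1 => //; exact: leq_trans le.
- by apply: h2; exact: leq_trans le.
- by apply: h3; exact: leq_trans le.
Qed.

Variables (m N : nat) (A : nat -> 'M[F]_N) (lam : seq nat) (t : 'I_N -> seq nat).
Let n := m.+1.
Hypothesis ne : (n.+1 < e)%N.
Hypothesis hA : hecke_seq alpha n.+1 A.
Hypothesis irr : forall J : pred 'I_N,
  (forall k i j, (k < n)%N -> J i -> A k i j != 0 -> J j) ->
  forall i0, J i0 -> forall i, J i.
Hypothesis t_inj : injective t.
Hypothesis t_tab : forall i, tableau n.+1 lam (t i).
Hypothesis t_surj : forall w, tableau n.+1 lam w -> exists i, t i = w.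
Hypothesis t_jm : forall k, (k < n)%N -> jm A k = diagf (fun i => alpha ^+ jm_exp (t i) k).

Let t_size i : size (t i) = n.+1. Proof. by case: (t_tab i). Qed.
Let t_yam i : yamanouchi (t i). Proof. by case: (t_tab i). Qed.
Let t_perm i j : perm_eq (t i) (t j). Proof. exact: tableau_perm (t_tab i) (t_tab j). Qed.
Let y i : F := jm A n i i.

Let t_rcons i : t i = rcons (take n (t i)) (nth 0%N (t i) n).
Proof. by rewrite -take_rcons ?t_size // -(t_size i) take_size. Qed.

Lemma prefix_last i j : perm_eq (take n (t i)) (take n (t j)) ->
  nth 0%N (t i) n = nth 0%N (t j) n.
Proof. exact: perm_last. Qed.

Lemma prefix_inj i j : take n (t i) = take n (t j) -> i = j.
Proof.
move=> h; apply: t_inj; rewrite t_rcons h (@prefix_last i j) ?h //.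
Qed.

(** The top element commutes with the lower ones, and the eigenvalues of the lower
    ones separate the basis vectors: they determine all letters but the last, and
    the shape determines that one. *)
Lemma top_jm : jm A n = diagf y.
Proof.
apply/matrixP => i j; rewrite diagfE; have [->//|ij] := eqVneq i j.
apply/eqP; apply: contraNT ij => nz; apply/eqP/prefix_inj.
apply: (@prefix_eq _ _ _ prim n.+1) => // k kn.
apply: (@comm_diagf _ _ (fun i => alpha ^+ jm_exp (t i) k) (jm A n)) nz.
rewrite -t_jm //; exact: (jm_commute (proj1 hA)).
Qed.

(** A generator below the top one exchanges two letters that precede the last, so
    it links vectors with the same last box; and it commutes with the top
    Jucys-Murphy element. *)
Lemma lower_edge k i j : (k < m)%N -> A k i j != 0 ->
  [/\ y i = y j, nth 0%N (t i) n = nth 0%N (t j) n & jm_exp (t i) n = jm_exp (t j) n].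
Proof.
move=> km nz; have [->//|ij] := eqVneq i j.
have pt : perm_eq (take n (t i)) (take n (t j)).
  have st i' : size (take n (t i')) = n by rewrite size_takel // t_size.
  have := @offdiag_word _ _ _ prim n N A (fun i => take n (t i)) (ltnW ne)
    (hecke_seqW (leqnSn n) hA) st (fun i => yam_take n (t_yam i)) _ k i j km ij nz.
  case=> [l ln| -> //| [-> _]].
    rewrite t_jm //; congr diag_mx; apply/rowP => i'; by rewrite !mxE jm_exp_take.
  by rewrite perm_sym perm_swap // st.
have el := prefix_last pt; split=> //; last exact: jm_exp_perm.
apply: (@comm_diagf _ _ y (A k)) nz.
rewrite -top_jm; apply: (jm_comm_gt (proj1 hA)) => //.
Qed.

(** A link i -- j exchanges the last two boxes. The top eigenvalue at i is alpha
    times the previous eigenvalue at j, and the last box of i is the last but one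
    of j. *)
Lemma top_edge i j : i != j -> A m i j != 0 ->
  y i = alpha ^+ jm_exp (t i) n /\ y j = alpha ^+ jm_exp (t j) n.
Proof.
move=> ij nz; have mn : (m < n)%N by [].
have nn : (n < n.+1)%N by [].
have [h1 h2] := jm_offdiag hA nn (t_jm mn) top_jm ij nz.
rewrite h1 h2 -!exprS.
have ek : take m (t i) = take m (t j).
  apply: (@prefix_eq _ _ _ prim n.+1) => // [|k km]; first lia.
  apply: (@comm_diagf _ _ (fun i => alpha ^+ jm_exp (t i) k) (A m)) nz.
  rewrite -t_jm; last by lia. exact: (jm_comm_lt (proj1 hA)).
have tE l : t l = take m (t l) ++ [:: nth 0%N (t l) m; nth 0%N (t l) n].
  by rewrite -[LHS]take_size t_size !take_rcons ?t_size // -!cats1 -catA.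
have pe := t_perm i j; rewrite (tE i) (tE j) ek perm_cat2l in pe.
have neq : t i != t j by apply: contra ij => /eqP/t_inj ->.
rewrite (tE i) (tE j) ek in neq; move: pe neq.
have cs : forall q l, (count_mem q (take m (t l)) <= m)%N.
  by move=> q l; apply: leq_trans (count_size _ _) _; rewrite size_takel // t_size; lia.
set a := nth _ (t i) m; set b := nth _ (t i) n; set a' := nth _ (t j) m; set b' := nth _ (t j) n.
move=> pe neq.
have [ea eb nab] : [/\ a' = b, b' = a & a != b].
  have : a' \in [:: a; b] by rewrite (perm_mem pe) mem_head.
  rewrite !inE => /orP[/eqP ea|/eqP ea].
    move: neq pe; rewrite ea (perm_cons a [:: b] [:: b']) => + /perm_mem/(_ b).
    by rewrite !inE eqxx => + /esym/eqP eb; rewrite eb eqxx.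
  have : perm_eq [:: b; a] [:: b; b'].
    by rewrite -ea -(permPr pe) ea; apply/seq.permP => p /=; lia.
  rewrite perm_cons => /perm_mem/(_ a); rewrite !inE eqxx => /esym/eqP eb.
  split=> //; apply: contraNneq neq => eab.
  by rewrite ea -eb eab.
have tm l : take n (t l) = rcons (take m (t l)) (nth 0%N (t l) m).
  by rewrite take_rcons // t_size /n; lia.
split; congr (_ ^+ _); rewrite /jm_exp tm -/a -/b -/a' -/b'.
  rewrite count_mem_rcons (negbTE nab) addn0 ea ek.
  by have := cs b j; rewrite /n; lia.
rewrite count_mem_rcons ea eb eq_sym (negbTE nab) addn0 ek.
by have := cs a j; rewrite /n; lia.
Qed.


Lemma two_letters v0 r q : size v0 = n -> dominant v0 -> tableau n.+1 lam (rcons v0 r) ->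
  (count_mem q.+1 v0 < count_mem q v0)%N ->
  exists i, [/\ nth 0%N (t i) m = q, nth 0%N (t i) n = r &
    forall x, count_mem x v0 = (count_mem x (take m (t i)) + (q == x))%N].
Proof.
move=> sv pv [_ yv cv] hq; have [v' pe yv'] := ex_yam_removable pv hq.
have sv' : size v' = m by have := perm_size pe; rewrite size_rcons sv => -[].
have pr : dominant (rcons v0 r) by have := yv n.+1; rewrite take_oversize // size_rcons sv.
have [|i ti] := t_surj (w := rcons (rcons v' q) r).
  split; first by rewrite !size_rcons sv'.
    apply: yam_rcons; first by apply: yam_rcons => //; apply: dominant_perm pv; rewrite perm_sym.
    by apply: dominant_perm pr; rewrite -!cats1 perm_cat2r perm_sym cats1.
  by move=> x; rewrite count_mem_rcons (seq.permP pe) -count_mem_rcons cv.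
exists i; rewrite ti; split.
- by rewrite !nth_rcons size_rcons sv' ltnSn ltnn eqxx.
- by rewrite nth_rcons size_rcons sv' ltnn eqxx.
- move=> x; rewrite -(seq.permP pe) count_mem_rcons -!cats1 -catA take_cat sv' ltnn subnn take0.
  by rewrite cats0.
Qed.

Lemma removable_last (i0 : 'I_N) r q : (forall i, nth 0%N (t i) n = r) ->
  (count_mem q.+1 (t i0) < count_mem q (t i0))%N -> q = r.
Proof.
move=> hr hq; have py : dominant (t i0) by have := t_yam i0 n.+1; rewrite -(t_size i0) take_size.
have [v pe yv] := ex_yam_removable py hq.
have [|i ti] := t_surj (w := rcons v q).
  split; first by rewrite (perm_size pe) t_size.
    by apply: yam_rcons => //; apply: dominant_perm py; rewrite perm_sym.
  by move=> x; rewrite (seq.permP pe); case: (t_tab i0).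
rewrite -(hr i) ti nth_rcons.
have : size (rcons v q) = n.+1 by rewrite -ti.
by rewrite size_rcons => -[->]; rewrite ltnn eqxx.
Qed.

(** The braid relation makes the last two generators equal, so the last three
    Jucys-Murphy eigenvalues are in geometric progression. *)
Lemma one_tableau (i0 : 'I_N) : (0 < m)%N ->
  (forall i j k, nth 0%N (t i) k = nth 0%N (t j) k) ->
  (jm_exp (t i0) m.-1 + jm_exp (t i0) n = jm_exp (t i0) m + jm_exp (t i0) m)%N ->
  y i0 == alpha ^+ jm_exp (t i0) n.
Proof.
move=> m0 same wtE; have a0 := prim_root_neq0 prim.
have one i : i = i0.
  by apply: t_inj; apply: (@eq_from_nth _ 0%N) => [|k _]; rewrite ?t_size.
have mul0 (B C : 'M[F]_N) : (B * C) i0 i0 = B i0 i0 * C i0 i0.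
  by rewrite mul_entry (bigD1 i0) //= big1 ?addr0 // => j; rewrite (one j) eqxx.
have nz k : (k < n)%N -> A k i0 i0 != 0.
  move=> kn; have /matrixP/(_ i0 i0) := proj2 hA k kn.
  rewrite mul0 !mxE eqxx !mulr1n => /eqP; rewrite mulf_eq0 addr_eq0 subr_eq0.
  by case/orP => /eqP ->; rewrite ?oppr_eq0 ?oner_eq0.
have := proj2 (proj1 hA) m.-1; rewrite prednK // => /(_ (ltnSn _)).
move=> /matrixP/(_ i0 i0); rewrite !mul0 => br.
have ab : A m.-1 i0 i0 = A m i0 i0.
  have nz1 : A m.-1 i0 i0 != 0 by apply: nz; rewrite /n; lia.
  apply: (mulIf (mulf_neq0 nz1 (nz m (ltnSn m)))).
  by rewrite [RHS]mulrA -br; ring.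
have x1 k : (k < n)%N -> jm A k i0 i0 = alpha ^+ jm_exp (t i0) k.
  by move=> kn; rewrite t_jm // diagfE eqxx.
have x2 : alpha ^+ jm_exp (t i0) m = A m i0 i0 * alpha ^+ jm_exp (t i0) m.-1 * A m i0 i0.
  by rewrite -x1 // -{1}(prednK m0) /= !mul0 ab x1 //; rewrite /n; lia.
apply/eqP/(mulfI (expf_neq0 (jm_exp (t i0) m.-1) a0)).
by rewrite -exprD wtE exprD {1}x2 /y /= !mul0 x1 //; ring.
Qed.

(** A diagonal top generator preserves the span of the vectors with a given last
    box. By irreducibility lam has a single removable box, that is, it is a
    rectangle, and the top Jucys-Murphy element is a scalar. If there are several
    rows and columns, the last but one box can be chosen to the left of the corner
    or above it. Both choices express the scalar as a known power of alpha times
    (-1) ^+ 2 or alpha ^+ 2, and only one combination is consistent when e > 4.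
    A single row or column has just one tableau. *)
Lemma top_diag_rectangle (i0 : 'I_N) : (0 < m)%N -> (forall i j, i != j -> A m i j = 0) ->
  exists i, y i == alpha ^+ jm_exp (t i) n.
Proof.
move=> m0 dA; pose b i := A m i i.
have nn : (n < n.+1)%N by [].
have mn1 : (m < n)%N by [].
have a0 := prim_root_neq0 prim.
have Ab : A m = diagf b.
  by apply/matrixP => i j; rewrite diagfE; have [->//|/dA->] := eqVneq i j.
have yE i : y i = b i * b i * alpha ^+ jm_exp (t i) m.
  rewrite /y /= Ab mulf_diag mul_diagf t_jm // diagfE eqxx mulr1n; ring.
have b_val i : b i = -1 \/ b i = alpha.
  have /matrixP/(_ i i) := proj2 hA m nn.
  rewrite Ab mul_entry (bigD1 i) //= big1 ?addr0 => [|j ji].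
    rewrite !mxE eqxx !mulr1n => /eqP; rewrite mulf_eq0 addr_eq0 subr_eq0.
    by case/orP => /eqP; [left | right].
  by rewrite !mxE (negbTE ji) (eq_sym i j) (negbTE ji) !mulr0n addr0 mul0r.
have y_const i j : y i = y j.
  apply/eqP; apply: (irr (J := fun i => y i == y j) _ (eqxx (y j))) => k i1 i2 kn /eqP <- nz.
  move: kn; rewrite ltnS leq_eqVlt => /orP[/eqP ek|km].
    by have [->//|/dA] := eqVneq i1 i2; rewrite -ek => /eqP; rewrite (negbTE nz).
  by have [-> _ _] := lower_edge km nz.
set r := nth 0%N (t i0) n.
have last_r i : nth 0%N (t i) n = r.
  apply/eqP; apply: (irr (J := fun i => nth 0%N (t i) n == r) _ (eqxx r)) => k i1 i2 kn /eqP <- nz.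
  move: kn; rewrite ltnS leq_eqVlt => /orP[/eqP ek|km].
    by have [->//|/dA] := eqVneq i1 i2; rewrite -ek => /eqP; rewrite (negbTE nz).
  by have [_ -> _] := lower_edge km nz.
have only_r q := @removable_last i0 r q last_r.
set w0 := t i0 in only_r; set v0 := take n w0.
have pw0 : dominant w0 by have := t_yam i0 n.+1; rewrite -(t_size i0) take_size.
have w0E : w0 = rcons v0 r by rewrite /w0 t_rcons.
have sv0 : size v0 = n by rewrite size_takel // t_size.
have cw q : count_mem q w0 = (count_mem q v0 + (r == q))%N by rewrite w0E count_mem_rcons.
have above q : (r < q)%N -> count_mem q w0 = 0%N.
  have [|q' q'w hq'] := @ex_max_row w0; first by rewrite t_size.
  have <- : q' = r; last exact: hq'.
  by apply: only_r; rewrite hq' // -has_count has_pred1.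
have tw0 : tableau n.+1 lam (rcons v0 r) by rewrite -w0E; exact: t_tab.
have two q := @two_letters v0 r q sv0 (t_yam i0 n) tw0.
(* r is the lowest row; the first two cases are a single row and a single column *)
have perm0 i q : count_mem q (t i) = count_mem q w0 by apply/seq.permP/t_perm.
case: (posnP r) => [r0|r1]; last case: (posnP (count_mem r v0)) => [c0|c1].
- have row i k : nth 0%N (t i) k = 0%N.
    by apply: row_word => q q0; rewrite perm0 above // r0.
  have wt0 k : (k <= n.+1)%N -> jm_exp w0 k = 0%N.
    move=> kn; rewrite /jm_exp row addn0 (@eq_in_count _ _ predT).
      by rewrite count_predT size_takel ?t_size // subnn.
    move=> x /mem_take /(nthP 0%N)[l _ <-]; rewrite row //.
  exists i0; apply: one_tableau => // [i j k|]; first by rewrite !row.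
  by rewrite !wt0 //; lia.
- have cr : count_mem r w0 = 1%N by rewrite cw c0 eqxx.
  have c1 q : (count_mem q w0 <= 1)%N.
    case: (ltnP r q) => [/above -> //|qr]; rewrite -(subKn qr).
    elim: (r - q)%N (leq_subr q r) => [|d IH] dr; first by rewrite subn0 cr.
    rewrite leqNgt; apply/negP => lt.
    suff : (r - d.+1 = r)%N by lia.
    by apply: only_r; rewrite subnSK // (leq_ltn_trans (IH (ltnW dr))).
  have col i k : (k <= n)%N -> nth 0%N (t i) k = k.
    by move=> kn; apply: column_word; rewrite ?t_size // => q; rewrite perm0.
  have wtk k : (k <= n)%N -> jm_exp w0 k = (k + k)%N.
    move=> kn; rewrite /jm_exp col // (_ : count_mem k _ = 0%N) ?subn0 //.
    apply/count_memPn/negP => /(nthP 0%N)[l].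
    have -> : size (take k w0) = k by rewrite size_takel // t_size; lia.
    by move=> lk; rewrite nth_take // col; lia.
  exists i0; apply: one_tableau => // [i j k|]; last by rewrite !wtk //; rewrite /n; lia.
  case: (leqP k n) => kn; first by rewrite !col.
  by rewrite !nth_default // t_size.
(* row r - 1 is as long as row r, for otherwise its last box would be removable *)
have c_above : (count_mem r.-1 v0 = (count_mem r v0).+1)%N.
  have : ~~ (count_mem r w0 < count_mem r.-1 w0)%N.
    apply/negP => lt; have := only_r r.-1; rewrite prednK // => /(_ lt); lia.
  have := pw0 r.-1; rewrite prednK // !cw eqxx (gtn_eqF (_ : (r.-1 < r)%N)); first lia.
  by rewrite prednK.
have [|i1 [m1 l1 k1]] := two r.
  by have := above r.+1 (ltnSn r); rewrite cw (ltn_eqF (ltnSn r)) addn0 => ->.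
have [|i2 [m2 l2 k2]] := two r.-1; first by rewrite prednK // c_above.
have two_rows : (count_mem r.-1 v0 + count_mem r v0 <= n)%N.
  by rewrite -sv0; apply: count2_leq_size; rewrite ltn_eqF // prednK.
exists i1; have := y_const i1 i2; rewrite !yE.
have wt1 : jm_exp (t i1) m = (m + r - (count_mem r v0).-1)%N.
  by rewrite /jm_exp m1 (k1 r) eqxx addn1.
have wt2 : jm_exp (t i2) m = (m + r.-1 - count_mem r v0)%N.
  by rewrite /jm_exp m2; have := k2 r.-1; rewrite eqxx addn1 c_above => -[->].
have wtn : jm_exp (t i1) n = (m.+1 + r - count_mem r v0)%N.
  rewrite /jm_exp l1; congr (_ - _)%N; rewrite take_rcons; last by rewrite t_size /n; lia.
  by rewrite count_mem_rcons m1 (k1 r).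
have {}wt1 : jm_exp (t i1) m = (jm_exp (t i2) m).+2 by rewrite wt1 wt2; lia.
have wtn1 : jm_exp (t i1) n = jm_exp (t i1) m by rewrite wtn wt1 wt2 /n; lia.
have e4 : (4 < e)%N by move: two_rows ne; rewrite /n; lia.
rewrite wt1 wtn1 !exprS !mulrA => /(mulIf (expf_neq0 _ a0)).
have ne2 : alpha ^+ 2 <> 1.
  by move=> h; have := @expr_inj_lt _ _ _ prim 2 0 h; lia.
have ne4 : alpha ^+ 4 <> 1.
  by move=> h; have := @expr_inj_lt _ _ _ prim 4 0 h; lia.
case: (b_val i1) => ->; case: (b_val i2) => -> h.
- by case: ne2; rewrite expr2; move: h; rewrite !mulrNN !mul1r.
- by rewrite wt1 !exprS; apply/eqP; ring.
- by case: ne4; rewrite !exprS expr0 mulr1 !mulrA h mulrNN mul1r.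
- by case: ne2; rewrite expr2; apply: (mulfI a0); apply: (mulfI a0); rewrite mulr1 !mulrA.
Qed.

(** The vectors on which the top eigenvalue is the expected one are closed under
    links, so by irreducibility one such vector is enough. *)
Lemma top_weights (i0 : 'I_N) : (0 < m)%N ->
  jm A n = diagf (fun i => alpha ^+ jm_exp (t i) n).
Proof.
move=> m0; rewrite top_jm; congr diag_mx; apply/rowP => i; rewrite !mxE; apply/eqP.
suff [i1 h1] : exists i, y i == alpha ^+ jm_exp (t i) n.
  apply: (irr (J := fun i => y i == alpha ^+ jm_exp (t i) n) _ h1) => k i2 j kn /eqP h2 nz.
  move: kn; rewrite ltnS leq_eqVlt => /orP[/eqP ek|km].
    have [<-|ij] := eqVneq i2 j; first by rewrite h2.
    by rewrite ek in nz; have [_ ->] := top_edge ij nz.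
  by have [<- _ <-] := lower_edge km nz; rewrite h2.
have [/existsP[i1 /existsP[j /andP[ij nz]]]|nex] :=
    boolP [exists i, [exists j, (i != j) && (A m i j != 0)]].
  by exists i1; have [-> _] := top_edge ij nz.
apply: (top_diag_rectangle i0 m0) => i1 j ij; apply/eqP; apply: contraNT nex => nz.
by apply/existsP; exists i1; apply/existsP; exists j; rewrite ij.
Qed.

End Step.

(** * Gelfand-Tsetlin bases of the Specht modules *)

Lemma two_box_weight (F : fieldType) (alpha : F) lam w :
  is_partition 2 lam -> tableau 2 lam w ->
  let a := if lam == [:: 2] then (-1)%R else alpha in (a * a = alpha ^+ jm_exp w 1)%R.
Proof.
case: w => [|r [|s [|? ?]]] // pl [] // _ yw cw /=.
have r0 : r = 0 by have := yam_head yw.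
have s1 : s <= 1.
  rewrite leqNgt; apply/negP => s1; have := @yam_filled [:: r; s] 1 isT yw 1 s1.
  by rewrite r0.
rewrite /jm_exp /= r0; case: eqP => [l2|nl2].
  have s0 : s = 0 by have := cw 0; rewrite l2 r0 /=; case: s {yw cw} s1.
  by rewrite s0 /= mulrNN mul1r.
case: s s1 yw cw => [|[|//]] _ yw cw; last by rewrite /= expr2.
case: nl2; have := cw 0; rewrite r0 /=; case/and3P: pl => _ + /eqP.
case: lam {cw} => [//|x l] /=; rewrite inE negb_or => /andP[_ nl] sl xE.
rewrite -xE in sl *; congr (_ :: _); case: l nl sl => [//|x' l] /=.
by rewrite inE negb_or => /andP[x0 _] h; exfalso; lia.
Qed.

Section Reps.
Local Open Scope ring_scope.
Variable F : fieldType.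

Section OneRep.
Variables (n N : nat) (R : brep F n N).

Lemma brepV x : R x *m R x^-1%g = 1%:M.
Proof. by rewrite -brepM mulgV brep1. Qed.

Lemma sigma_inv (i : 'I_n.-1) : bclass [:: (i, true)] = (sigma i)^-1%g.
Proof. by rewrite -[RHS]bclass_winv. Qed.

Lemma bclassM (u v : bword n) : bclass (u ++ v) = (bclass u * bclass v)%g.
Proof. exact: bclass_cat. Qed.

Lemma brep_ind (K : 'M[F]_N -> Prop) : K 1%:M -> (forall B C, K B -> K C -> K (B *m C)) ->
  (forall i, K (R (sigma i))) -> (forall i, K (R (sigma i)^-1%g)) -> forall x, K (R x).
Proof.
move=> K1 KM Ks Kv x; rewrite -(bclass_repr x).
elim: (generic_quotient.repr x) => [|[i s] u IH].
  by rewrite (brep1 R).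
rewrite -cat1s bclassM brepM; apply: KM => //.
by case: s; [rewrite sigma_inv; exact: Kv | exact: Ks].
Qed.

(** Indexed by nat so that the restriction to fewer strands keeps the indices. *)
Definition gen_mx k : 'M[F]_N := oapp (fun i : 'I_n.-1 => R (sigma i)) 1 (insub k).

Lemma gen_mx_ord (i : 'I_n.-1) : gen_mx i = R (sigma i).
Proof. by rewrite /gen_mx valK. Qed.

Lemma gen_mx_lt k (kn : (k < n.-1)%N) : gen_mx k = R (sigma (Ordinal kn)).
Proof. by rewrite -gen_mx_ord. Qed.

Lemma gen_mx_hecke alpha : hecke_rep alpha R -> hecke_seq alpha n gen_mx.
Proof.
move=> h; have lt1 i : (i.+1 < n)%N -> (i < n.-1)%N by case: (n).
split; last by move=> i i_n; rewrite (gen_mx_lt (lt1 i i_n)) -mulmxE; exact: h.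
split=> [i j ij jn | i i_n].
  have i_n : (i.+1 < n)%N by lia.
  rewrite (gen_mx_lt (lt1 i i_n)) (gen_mx_lt (lt1 j jn)).
  rewrite -!mulmxE -!brepM; congr (R _); rewrite /sigma -!bclassM.
  by apply/bclassP; apply: bcong_far.
rewrite (gen_mx_lt (lt1 i (ltnW i_n))) (gen_mx_lt (lt1 i.+1 i_n)).
rewrite -!mulmxE -!brepM; congr (R _); rewrite /sigma -!bclassM.
by apply/bclassP; apply: bcong_braid.
Qed.

End OneRep.

Definition conj_seq N (P : 'M[F]_N) (A : nat -> 'M[F]_N) k := P *m A k *m invmx P.

Lemma conjM N (P A B : 'M[F]_N) : P \in unitmx ->
  (P *m A *m invmx P) *m (P *m B *m invmx P) = P *m (A *m B) *m invmx P.
Proof. by move=> uP; rewrite !mulmxA mulmxKV. Qed.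

Lemma conj_hecke alpha n N (P : 'M[F]_N) A : P \in unitmx ->
  hecke_seq alpha n A -> hecke_seq alpha n (conj_seq P A).
Proof.
move=> uP [[h1 h2] h3]; split; first split.
- by move=> i j ij jn; rewrite -!mulmxE !conjM // !mulmxE h1.
- by move=> i i_n; rewrite -!mulmxE !conjM // !mulmxE h2.
move=> i i_n; have sc a : a%:M = P *m a%:M *m invmx P.
  by rewrite mul_mx_scalar -scalemxAl mulmxV // scalemx1.
rewrite /conj_seq -[1]/1%:M (sc 1) (sc alpha) -!mulmxDl -!mulmxDr -mulNmx -mulmxN -mulmxDl -mulmxDr.
by rewrite -mulmxE conjM // mulmxE h3 // mulr0 mul0r.
Qed.

Lemma mxdiagM k (d : 'I_k -> nat) (B C : forall i, 'M[F]_(d i)) :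
  mxdiag B *m mxdiag C = mxdiag (fun i => B i *m C i).
Proof.
rewrite {2}/mxdiag mul_mxdiag_mxblock; apply: eq_mxblock => i j.
case: eqVneq => [eq_ij|_]; last by rewrite mulmx0.
by case: _ / eq_ij; rewrite !conform_mx_id.
Qed.

Lemma jm_mxdiag k (d : 'I_k -> nat) (B : forall i, nat -> 'M[F]_(d i)) l :
  jm (fun l => mxdiag (fun i => B i l)) l = mxdiag (fun i => jm (B i) l).
Proof.
elim: l => [|l IH] /=; first exact/esym/mxdiagZ.
by rewrite IH -!mulmxE !mxdiagM.
Qed.

Section Irreducible.
Variables (alpha : F) (n N : nat) (R : brep F n N).
Hypotheses (a0 : alpha != 0) (hR : hecke_rep alpha R).

(** By the quadratic relation the inverse is a polynomial in the generator, so a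
    subspace that the generators preserve is invariant. *)
Lemma sigma_inverse i :
  R (sigma i)^-1%g = alpha^-1 *: (R (sigma i) - (alpha - 1)%:M).
Proof.
have h := hR i.
have : R (sigma i) *m (alpha^-1 *: (R (sigma i) - (alpha - 1)%:M)) = 1%:M.
  rewrite -scalemxAr; apply: (scalerI a0); rewrite scalerA divff // scale1r scalemx1.
  apply/eqP; rewrite -subr_eq0 -h; apply/eqP.
  rewrite mulmxDl mul1mx !mulmxBr !mul_mx_scalar scalerBl scale1r opprB [RHS]addrA.
  by congr (_ - _); rewrite addrA addrAC.
move=> v; have := congr1 (mulmx (R (sigma i)^-1%g)) v.
by rewrite mulmxA -brepM mulVg brep1 mul1mx mulmx1.
Qed.

Lemma irreducible_closed (P : 'M[F]_N) (J : pred 'I_N) : irreducible_rep R ->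
  P \in unitmx ->
  (forall k i j, (k < n.-1)%N -> J i -> conj_seq P (gen_mx R) k i j != 0 -> J j) ->
  forall i0, J i0 -> forall i, J i.
Proof.
move=> [_ irr] uP hJ i0 Ji0 i; pose D := diagf (fun i => (J i)%:R : F).
have stg k : stablemx (D *m P) (R (sigma k)).
  have cl : D *m conj_seq P (gen_mx R) k = D *m conj_seq P (gen_mx R) k *m D.
    apply/matrixP => i1 j1; rewrite !mulmxE mulf_diag mul_diagf.
    have [Jj|nJj] := boolP (J j1); first by rewrite mulr1.
    rewrite mulr0; have [Ji|nJi] := boolP (J i1); last by rewrite mul0r.
    by rewrite mul1r; apply/eqP; apply: contraNT nJj => nz; exact: hJ nz.
  have -> : D *m P *m R (sigma k) = (D *m conj_seq P (gen_mx R) k) *m P.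
    by rewrite /conj_seq gen_mx_ord !mulmxA mulmxKV.
  by rewrite cl -mulmxA submxMl.
have st x : stablemx (D *m P) (R x).
  apply: (@brep_ind _ _ R (fun M => stablemx (D *m P) M)) => {x}.
  - exact: stablemxC.
  - by move=> B C; exact: stablemxM.
  - exact: stg.
  - move=> k; rewrite sigma_inverse -mul_mx_scalar; apply: stablemxM (stablemxC _ _).
    by apply: stablemxD; rewrite ?stablemxN ?stablemxC ?stg.
case: (irr _ st) => [D0|].
  have /matrixP/(_ i0 i0) : D = 0 by rewrite -[D](mulmxK uP) D0 mul0mx.
  by rewrite diagfE eqxx Ji0 mxE => /eqP; rewrite oner_eq0.
rewrite row_full_unit unitmx_mul uP andbT unitmxE det_diag unitfE => /prodf_neq0/(_ i isT).
by rewrite mxE; case: (J i); rewrite ?eqxx.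
Qed.
End Irreducible.

(** A basis adapted to the restrictions to B_1, B_2, ..., in the form used below:
    an eigenbasis of the Jucys-Murphy elements labelled by the tableaux. *)
Definition gelfand_tsetlin alpha n N lam (A : nat -> 'M[F]_N) (t : 'I_N -> seq nat) :=
  [/\ injective t, forall i, tableau n lam (t i),
      forall w, tableau n lam w -> exists i, t i = w
    & forall k, (k < n)%N -> jm A k = diagf (fun i => alpha ^+ jm_exp (t i) k)].

Lemma iso_rep_sq n N N' (R : brep F n N) (R' : brep F n N') : iso_rep R R' -> N = N'.
Proof. by case=> P [/eqP rN /eqP rN' _]; rewrite -[LHS]rN. Qed.

Lemma gen_mx_res n N (R : brep F n.+1 N) k : (k < n.-1)%N -> gen_mx R k = gen_mx (res_rep R) k.
Proof.
move=> kn; have kn1 : (k < n.+1.-1)%N by case: (n) kn => // m; exact: ltnW.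
rewrite (gen_mx_lt _ kn) (gen_mx_lt _ kn1) /= bincl_bclass /sigma /wincl /=.
by congr (R (bclass [:: (_, _)])); apply: val_inj.
Qed.

(** The bases of the summands of the restriction are put together, every word being
    extended by the row of the removed box. Only the eigenvalues of the last
    Jucys-Murphy element are new, and they are computed by top_weights. *)
Lemma specht_gelfand_tsetlin alpha e n lam N (R : brep F n N) : e.-primitive_root alpha ->
  (n < e)%N -> specht_rep alpha lam R ->
  exists P t, P \in unitmx /\ gelfand_tsetlin alpha n lam (conj_seq P (gen_mx R)) t.
Proof.
move=> prim; elim: n lam N R => [|n IH] lam N R ne /=.
  move=> [-> N1]; subst N; exists 1%:M, (fun=> [::]); split; first exact: unitmx1.
  split=> //; first by move=> i j _; rewrite !ord1.
    by move=> i; split=> // r; rewrite nth_nil.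
  by move=> w [/size0nil -> _ _]; exists ord0.
move=> [pl hR irrR R2 [d [S [hS iso]]]].
have [B hB] : exists B : forall i, 'M[F]_(d i) * ('I_(d i) -> seq nat), forall i,
    (B i).1 \in unitmx /\ gelfand_tsetlin alpha n (nth [::] (box_removals lam) i)
      (conj_seq (B i).1 (gen_mx (S i))) (B i).2.
  apply: (@fin_all_exists _ (fun i => 'M[F]_(d i) * ('I_(d i) -> seq nat))%type
    (fun i Bi => Bi.1 \in unitmx /\ gelfand_tsetlin alpha n (nth [::] (box_removals lam) i)
      (conj_seq Bi.1 (gen_mx (S i))) Bi.2)) => i.
  have [P [t h]] := IH _ _ (S i) (ltnW ne) (hS i).
  by exists (P, t).
have eN := iso_rep_sq iso; subst N; case: iso => P0 [uP0 _ hP0].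
rewrite row_free_unit in uP0.
pose Q := mxdiag (fun i => (B i).1); pose Q' := mxdiag (fun i => invmx (B i).1).
have QQ' : Q *m Q' = 1%:M.
  rewrite mxdiagM -[RHS]mxdiagZ; apply: eq_mxdiag => i; rewrite mulmxV //.
  by have [] := hB i.
have [uQ iQ] : Q \in unitmx /\ invmx Q = Q'.
  have [uQ _] := mulmx1_unit QQ'; split=> //.
  by rewrite -[LHS]mulmx1 -QQ' mulKmx.
pose P := Q *m invmx P0.
have uP : P \in unitmx by rewrite unitmx_mul uQ unitmx_inv.
pose t (I : 'I_(\sum_i d i)) : seq nat := rcons ((B (tagnat.sig1 I)).2 (tagnat.sig2 I))
  (nth 0%N (removable_rows lam) (tagnat.sig1 I)).
pose A := conj_seq P (gen_mx R).
have hA : hecke_seq alpha n.+1 A by apply: conj_hecke => //; exact: gen_mx_hecke.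
have lt_rows (i : 'I_(size (box_removals lam))) : (i < size (removable_rows lam))%N.
  by apply: leq_trans (ltn_ord i) _; rewrite size_map.
have bE (i : 'I_(size (box_removals lam))) :
    nth [::] (box_removals lam) i = remove_box lam (nth 0%N (removable_rows lam) i).
  by rewrite (nth_map 0%N) // lt_rows.
have rE (i : 'I_(size (box_removals lam))) : nth 0%N (removable_rows lam) i \in removable_rows lam.
  by apply: mem_nth; rewrite lt_rows.
have Alow k : (k < n.-1)%N -> A k = mxdiag (fun i => conj_seq (B i).1 (gen_mx (S i)) k).
  move=> kn; rewrite /A /conj_seq gen_mx_res // (gen_mx_lt _ kn) -!mxdiagM.
  have := hP0 (sigma (Ordinal kn)); rewrite /= => hk.
  have -> : R (bincl (sigma (Ordinal kn))) =
      P0 *m mxdiag (fun i => S i (sigma (Ordinal kn))) *m invmx P0.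
    by rewrite -hk mulmxK.
  apply: (can_inj (mulmxK uP)); rewrite mulmxKV // /P !mulmxA mulmxKV //.
  have -> : mxdiag (fun i => gen_mx (S i) k) = mxdiag (fun i => S i (sigma (Ordinal kn))).
    by apply: eq_mxdiag => i; rewrite gen_mx_lt.
  by rewrite -/Q' -iQ -/Q mulmxKV.
have t_jm k : (k < n)%N -> jm A k = diagf (fun i => alpha ^+ jm_exp (t i) k).
  move=> kn; rewrite (@eq_jm _ _ (fun l => mxdiag (fun i => conj_seq (B i).1 (gen_mx (S i)) l))).
    rewrite jm_mxdiag.
    have -> : mxdiag (fun i => jm (conj_seq (B i).1 (gen_mx (S i))) k) =
      mxdiag (fun i => diagf (fun j => alpha ^+ jm_exp ((B i).2 j) k)).
      by apply: eq_mxdiag => i; have [_ [_ _ _ ->]] := hB i.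
    rewrite /diagf -diag_mxrow; congr diag_mx; apply/rowP => I; rewrite !mxE.
    congr (alpha ^+ _); rewrite -(@jm_exp_take (t I) n) // /t -cats1 take_cat.
    have [_ [_ /(_ (tagnat.sig2 I)) [-> _ _] _ _]] := hB (tagnat.sig1 I).
    by rewrite ltnn subnn take0 cats0.
  by move=> j jk; apply: Alow; lia.
exists P, t; split=> //.
have t_inj : injective t.
  move=> I J; rewrite /t => /rcons_inj[e2 e1]; apply: tagnat.sig_inj; rewrite !tagnat.sigE12.
  have e1' : tagnat.sig1 I = tagnat.sig1 J.
    apply: val_inj; apply/eqP; move/eqP: e1; rewrite nth_uniq ?lt_rows //.
    by rewrite filter_uniq ?iota_uniq.
  move: (tagnat.sig1 I) (tagnat.sig1 J) (tagnat.sig2 I) (tagnat.sig2 J) e1' e2 {e1}.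
  move=> i j x y ij; case: _ / ij y => y e2; congr Tagged.
  by have [_ [tB _ _ _]] := hB i; exact: tB.
have t_tab i : tableau n.+1 lam (t i).
  apply: tableau_rcons => //; rewrite -bE; have [_ [_ + _ _]] := hB (tagnat.sig1 i); exact.
have t_surj w : tableau n.+1 lam w -> exists i, t i = w.
  move=> /(tableau_inv pl) [r [w' [rr -> tw']]].
  have ir : (index r (removable_rows lam) < size (box_removals lam))%N.
    by rewrite size_map index_mem.
  have := hB (Ordinal ir); rewrite bE /= nth_index // => -[_ [_ _ sB _]].
  have [j jw] := sB _ tw'; exists (tagnat.Rank (Ordinal ir) j).
  by rewrite /t /tagnat.sig1 /tagnat.sig2 /tagnat.Rank tagnat.rankK /= jw nth_index.
split=> // k; rewrite ltnS leq_eqVlt => /orP[/eqP->|]; last exact: t_jm.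
have N0 : (0 < \sum_i d i)%N by case: irrR.
case: n => [|[|m]] in IH ne R pl hR irrR R2 S hS B hB hP0 Q Q' QQ' uQ iQ
  P uP t A hA bE rE Alow t_jm t_inj t_tab t_surj *.
- apply/matrixP => i j; rewrite diagfE !mxE /jm_exp take0 add0n subn0.
  by have [_ yi _] := t_tab i; rewrite yam_head // expr0.
- have AE : A 0%N = (if lam == [:: 2%N] then -1 else alpha)%:M.
    rewrite /A /conj_seq (gen_mx_lt R (isT : (0 < 2.-1)%N)) R2 //.
    by rewrite mul_mx_scalar -scalemxAl mulmxV // scalemx1.
  have -> : jm A 1 = A 0%N *m A 0%N by rewrite /= mulr1.
  rewrite AE -scalar_mxM; apply/matrixP => i j; rewrite diagfE mxE.
  by congr (_ *+ _); apply: two_box_weight.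
apply: (@top_weights _ _ _ prim m.+1) => //; last exact: Ordinal N0.
move=> J hJ j0 Jj0; exact: (irreducible_closed (prim_root_neq0 prim) hR irrR uP hJ Jj0).
Qed.
End Reps.

(** * A diamond lemma for multiplicative cocycles *)

Section DiamondLemma.
Local Open Scope ring_scope.
Variables (F : fieldType) (I : finType) (n : nat).
Variables (D : nat -> I -> bool) (s : nat -> I -> I) (rank : I -> nat).
Variables (g : nat -> I -> F) (G : F -> Prop).
Hypotheses (G1 : G 1) (GM : forall x y, G x -> G y -> G (x * y)).
Hypothesis Gg : forall k i, D k i -> G (g k i).
Hypothesis D_lt : forall k i, D k i -> (k < n)%N.
Hypothesis rank_lt : forall k i, D k i -> (rank (s k i) < rank i)%N.
Hypothesis square : forall j k i, D j i -> D k i -> (j.+1 < k)%N ->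
  [/\ D k (s j i), D j (s k i), s k (s j i) = s j (s k i)
    & g j i * g k (s j i) = g k i * g j (s k i)].
Hypothesis hexagon : forall k i, D k i -> D k.+1 i ->
  let a := s k i in let b := s k.+1 i in
  let a' := s k.+1 a in let b' := s k b in
  [/\ [/\ D k.+1 a, D k a', D k b & D k.+1 b'], s k a' = s k.+1 b'
    & g k i * g k.+1 a * g k a' = g k.+1 i * g k b * g k.+1 b'].

(** Newman's diamond lemma with coefficients: the values of h are defined by
    descending along any D-move, and the relations on squares and hexagons make
    the result independent of the move. The predicate G is a property of the
    ratios, to be inherited by h. *)
Lemma ex_potential : exists h : I -> F,
  (forall i, G (h i)) /\ forall k i, D k i -> h i = g k i * h (s k i).
Proof.
have H m : exists h : I -> F, (forall i, G (h i)) /\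
    forall k i, (rank i < m)%N -> D k i -> h i = g k i * h (s k i).
  elim: m => [|m [h [Gh hm]]]; first by exists (fun=> 1).
  (* two moves from i are completed to a square or a hexagon *)
  have confl j k i : rank i = m -> D j i -> D k i -> (j < k)%N ->
      g j i * h (s j i) = g k i * h (s k i).
    move=> ri Dj Dk jk; have rj := rank_lt Dj; have rk := rank_lt Dk; rewrite ri in rj rk.
    move: jk; rewrite leq_eqVlt => /orP[/eqP ejk|jk].
      rewrite -ejk in Dk rk *; have [[D1 D2 D3 D4] eS eg] := hexagon Dj Dk.
      rewrite (hm _ _ rj D1) (hm _ _ (ltn_trans (rank_lt D1) rj) D2) eS !mulrA eg.
      by rewrite (hm _ _ rk D3) (hm _ _ (ltn_trans (rank_lt D3) rk) D4) !mulrA.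
    have [D1 D2 eS eg] := square Dj Dk jk.
    by rewrite (hm _ _ rj D1) (hm _ _ rk D2) eS !mulrA eg.
  have confl' j k i : rank i = m -> D j i -> D k i -> g j i * h (s j i) = g k i * h (s k i).
    move=> ri Dj Dk; case: (ltngtP j k) => [|jk|-> //]; first exact: confl.
    exact/esym/confl.
  pose h' i := if rank i == m then
      (if [pick k : 'I_n | D k i] is Some k then g k i * h (s k i) else 1) else h i.
  exists h'; split=> [i|k i].
    by rewrite /h'; case: ifP => // _; case: pickP => [k Dk|_] //; apply: GM => //; exact: Gg.
  rewrite ltnS leq_eqVlt => /orP[/eqP ri|ri] Dk; have rk := rank_lt Dk.
    rewrite /h' ri eqxx ltn_eqF -?ri //; case: pickP => [k' Dk'|/(_ (Ordinal (D_lt Dk)))].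
      exact: confl'.
    by rewrite /= Dk.
  by rewrite /h' ltn_eqF // ltn_eqF ?(ltn_trans rk ri) //; exact: hm.
have [h [Gh hm]] := H (\max_i rank i).+1; exists h; split=> // k i.
by apply: hm; rewrite ltnS; exact: (leq_bigmax i).
Qed.
End DiamondLemma.

(** * The invariant Hermitian form *)

Section Products.
Local Open Scope ring_scope.
Variables (F : fieldType) (N : nat).

Lemma big_path (f : 'I_N -> F) m : (forall l, f l != 0 -> l = m) -> \sum_l f l = f m.
Proof.
move=> h; rewrite (bigD1 m) //= big1 ?addr0 // => l lm.
by apply/eqP; apply: contraNT lm => /h ->.
Qed.

Lemma path2 (A B : 'M[F]_N) u v m :
  (forall l, A u l != 0 -> B l v != 0 -> l = m) -> (A * B) u v = A u m * B m v.
Proof.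
move=> h; rewrite mul_entry; apply: (big_path (f := fun l => A u l * B l v)) => l.
by rewrite mulf_eq0 negb_or => /andP[]; exact: h.
Qed.

(** A single path of nonzero entries leads from u to v. *)
Lemma path3 (A B : 'M[F]_N) u v m1 m2 :
  (forall l1 l2, A u l1 != 0 -> B l1 l2 != 0 -> A l2 v != 0 -> l1 = m1 /\ l2 = m2) ->
  (A * B * A) u v = A u m1 * B m1 m2 * A m2 v.
Proof.
move=> h; rewrite mul_entry; rewrite (big_path (m := m2)) => [|l].
  have [->|nz] := eqVneq (A m2 v) 0; first by rewrite !mulr0.
  by congr (_ * _); apply: path2 => l /h h1 /h1 /(_ nz) [].
rewrite mul_entry mulf_eq0 negb_or => /andP[+ nz]; rewrite (big_path (m := m1)) => [|l1].
  by rewrite mulf_eq0 negb_or => /andP[a b]; have [] := h _ _ a b nz.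
by rewrite mulf_eq0 negb_or => /andP[a b]; have [] := h _ _ a b nz.
Qed.
End Products.

Section Hermitian.
Local Open Scope ring_scope.
Variables (F : fieldType) (alpha : F) (e : nat).
Hypothesis prim : e.-primitive_root alpha.
Variables (n N : nat) (A : nat -> 'M[F]_N) (lam : seq nat) (t : 'I_N -> seq nat).
Hypothesis ne : (n < e)%N.
Hypothesis hA : hecke_seq alpha n A.
Hypothesis gtA : gelfand_tsetlin alpha n lam A t.
Variable phi : {rmorphism F -> F}.
Hypothesis phi_alpha : phi alpha = alpha^-1.
Hypothesis phiK : involutive phi.

Let t_inj : injective t. Proof. by case: gtA. Qed.
Let t_tab i : tableau n lam (t i). Proof. by have [_ + _ _] := gtA; exact. Qed.
Let t_surj w : tableau n lam w -> exists i, t i = w. Proof. by have [_ _ + _] := gtA; exact. Qed.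
Let t_jm k : (k < n)%N -> jm A k = diagf (fun i => alpha ^+ jm_exp (t i) k).
Proof. by have [_ _ _ +] := gtA; exact. Qed.
Let t_size i : size (t i) = n. Proof. by case: (t_tab i). Qed.
Let t_yam i : yamanouchi (t i). Proof. by case: (t_tab i). Qed.
Let a0 : alpha != 0 := prim_root_neq0 prim.

Lemma gt_edge k i j : (k.+1 < n)%N -> i != j -> A k i j != 0 ->
  t j = swap k (t i) /\ nth 0%N (t i) k != nth 0%N (t i) k.+1.
Proof.
move=> kn ij nz; have [/t_inj ji|//] := offdiag_word prim ne hA t_size t_yam t_jm kn ij nz.
by rewrite ji eqxx in ij.
Qed.

Lemma gt_edge_fixed k i j m : (k.+1 < n)%N -> (m < k)%N || (k.+1 < m)%N -> A k i j != 0 ->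
  nth 0%N (t j) m = nth 0%N (t i) m.
Proof.
move=> kn km nz; have [->//|ij] := eqVneq i j; have [-> _] := gt_edge kn ij nz.
by rewrite nth_swap ?t_size // adj_swap_out.
Qed.

Lemma gt_edge_swap k i j m : (k.+1 < n)%N -> A k i j != 0 ->
  nth 0%N (t j) m != nth 0%N (t i) m -> t j = swap k (t i).
Proof.
move=> kn nz neq; have ij : i != j by apply: contra_neq neq => ->.
by have [] := gt_edge kn ij nz.
Qed.

(** The factor A k does not touch position j, so the first step must change it. *)
Lemma far_path j k u v m : (j.+1 < n)%N -> (k.+1 < n)%N -> (j.+1 < k)%N || (k.+1 < j)%N ->
  nth 0%N (t v) j != nth 0%N (t u) j -> t m = swap j (t u) ->
  (A j * A k) u v = A j u m * A k m v.
Proof.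
move=> jn kn jk neq tm; apply: path2 => l ul lv; apply: t_inj; rewrite tm.
apply: (gt_edge_swap (m := j) jn ul); rewrite -(gt_edge_fixed (m := j) kn _ lv) //.
by lia.
Qed.

Section BraidPaths.
Variables (k : nat) (u v m1 m2 : 'I_N).
Hypothesis kn : (k.+2 < n)%N.
Hypotheses (v0 : nth 0%N (t v) k = nth 0%N (t u) k.+2)
  (v1 : nth 0%N (t v) k.+1 = nth 0%N (t u) k.+1)
  (v2 : nth 0%N (t v) k.+2 = nth 0%N (t u) k).
Hypotheses (d02 : nth 0%N (t u) k != nth 0%N (t u) k.+2)
  (d01 : nth 0%N (t u) k != nth 0%N (t u) k.+1)
  (d12 : nth 0%N (t u) k.+1 != nth 0%N (t u) k.+2).

(** Reversing three distinct letters takes three exchanges, so no factor can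
    contribute a diagonal entry. *)
Lemma low_path : t m1 = swap k (t u) -> t m2 = swap k (t v) ->
  (A k * A k.+1 * A k) u v = A k u m1 * A k.+1 m1 m2 * A k m2 v.
Proof.
move=> tm1 tm2; have kn1 := ltnW kn; apply: path3 => l1 l2 ul ll lv.
have l2z : nth 0%N (t l2) k.+2 = nth 0%N (t u) k.
  by rewrite -v2; apply/esym/(gt_edge_fixed kn1) => //; rewrite ltnSn orbT.
have l1z : nth 0%N (t l1) k.+2 = nth 0%N (t u) k.+2.
  by apply: (gt_edge_fixed kn1) => //; rewrite ltnSn orbT.
have sl : t l2 = swap k.+1 (t l1).
  by apply: (gt_edge_swap (m := k.+2) kn ll); rewrite l2z l1z.
have sz : (k.+2 < size (t l1))%N by rewrite t_size.
have l1y : nth 0%N (t l1) k.+1 = nth 0%N (t u) k.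
  by rewrite -l2z sl nth_swap // adj_swap_r.
have l2y : nth 0%N (t l2) k.+1 = nth 0%N (t u) k.+2 by rewrite sl nth_swap // adj_swap_l.
split; apply: t_inj.
  by rewrite tm1; apply: (gt_edge_swap (m := k.+1) kn1 ul); rewrite l1y.
rewrite tm2 (gt_edge_swap (m := k.+1) kn1 lv) ?swapK ?t_size //.
by rewrite v1 l2y.
Qed.

Lemma high_path : t m1 = swap k.+1 (t u) -> t m2 = swap k.+1 (t v) ->
  (A k.+1 * A k * A k.+1) u v = A k.+1 u m1 * A k m1 m2 * A k.+1 m2 v.
Proof.
move=> tm1 tm2; have kn1 := ltnW kn; apply: path3 => l1 l2 ul ll lv.
have l2z : nth 0%N (t l2) k = nth 0%N (t u) k.+2.
  by rewrite -v0; apply/esym/(gt_edge_fixed kn) => //; rewrite ltnSn.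
have l1z : nth 0%N (t l1) k = nth 0%N (t u) k.
  by apply: (gt_edge_fixed kn) => //; rewrite ltnSn.
have sl : t l2 = swap k (t l1).
  by apply: (gt_edge_swap (m := k) kn1 ll); rewrite l2z l1z eq_sym.
have sz : (k.+1 < size (t l1))%N by rewrite t_size.
have l1y : nth 0%N (t l1) k.+1 = nth 0%N (t u) k.+2.
  by rewrite -l2z sl nth_swap // adj_swap_l.
have l2y : nth 0%N (t l2) k.+1 = nth 0%N (t u) k by rewrite sl nth_swap // adj_swap_r.
split; apply: t_inj.
  by rewrite tm1; apply: (gt_edge_swap (m := k.+1) kn ul); rewrite l1y eq_sym.
rewrite tm2 (gt_edge_swap (m := k.+1) kn lv) ?swapK ?t_size //.
by rewrite v1 l2y eq_sym.
Qed.
End BraidPaths.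

(* The moves: exchanging a descent at k, which leads to s k i. *)
Let D k i := (k.+1 < n)%N && (nth 0%N (t i) k.+1 < nth 0%N (t i) k)%N.
Let s k i : 'I_N := odflt i [pick j | t j == swap k (t i)].

Let D_lt k i : D k i -> (k.+1 < n)%N. Proof. by case/andP. Qed.

Lemma t_s k i : D k i -> t (s k i) = swap k (t i).
Proof.
case/andP=> kn lt; have kn' : (k.+1 < size (t i))%N by rewrite t_size.
rewrite /s; case: pickP => [j /eqP //|no].
have [|j tj] := t_surj (w := swap k (t i)); last by have := no j; rewrite tj eqxx.
have [sz y c] := t_tab i; split; first by rewrite size_swap.
  exact: yam_swap_descent.
by move=> r; rewrite (seq.permP (perm_swap kn')).
Qed.

Lemma nth_s k i m : D k i -> nth 0%N (t (s k i)) m = nth 0%N (t i) (adj_swap k m).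
Proof. by move=> Dk; rewrite t_s // nth_swap // t_size (D_lt Dk). Qed.

Lemma s_neq k i : D k i -> i != s k i.
Proof.
move=> Dk; apply/eqP => h; have := nth_s k Dk; rewrite -h adj_swap_l => eq.
by case/andP: Dk; rewrite eq ltnn.
Qed.

(** The diagonal part of unitarity. It holds because phi inverts alpha and the two
    eigenvalues in the formula for the diagonal entry. *)
Lemma phi_diag k i : (k.+1 < n)%N -> alpha * phi (A k i i) = A k i i - (alpha - 1).
Proof.
move=> kn; have := jm_diag hA kn (t_jm (ltnW kn)) (t_jm kn) i.
set x := alpha ^+ jm_exp _ k; set x' := alpha ^+ _; set a := A k i i => h.
have [x0 x'0] : x != 0 /\ x' != 0 by rewrite !expf_neq0.
have a1 : alpha - 1 != 0.
  rewrite subr_eq0; apply/eqP => a1.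
  by have := @expr_inj_lt _ _ _ prim 1 0; rewrite expr1 expr0 a1 => /(_ erefl); lia.
have phix y : phi (alpha ^+ y) = (alpha ^+ y)^-1 by rewrite rmorphXn /= phi_alpha exprVn.
have [px px'] : phi x = x^-1 /\ phi x' = x'^-1 by rewrite !phix.
clearbody x x'; have := congr1 phi h; rewrite !rmorphM !rmorphB /= px px' phi_alpha rmorph1.
set f := phi a => hf.
have hf' : x * (alpha * f - 1 + alpha) = f * x'.
  have := congr1 (fun z => z * (x * x' * alpha)) hf.
  have -> : x'^-1 * (f - (alpha^-1 - 1)) * (x * x' * alpha) = x * (alpha * f - 1 + alpha).
    by field; rewrite a0 x'0.
  by move=> ->; field; rewrite a0 x0.
have ne0 : x' - alpha * x != 0.
  apply/eqP => /eqP; rewrite subr_eq0 => /eqP ex.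
  have : (alpha - 1) * x' = 0.
    have -> : (alpha - 1) * x' = a * (x' - alpha * x).
      by rewrite mulrBr; move: h; rewrite mulrBr => /eqP; rewrite subr_eq => /eqP E;
         rewrite (mulrC a) E; ring.
    by rewrite ex subrr mulr0.
  by move/eqP; rewrite mulf_eq0 (negbTE a1) (negbTE x'0).
apply: (mulIf ne0); apply/eqP; rewrite -subr_eq0; apply/eqP.
transitivity (alpha * (f * x' - x * (alpha * f - 1 + alpha)) -
   (x' * (a - (alpha - 1)) - alpha * a * x)); first by ring.
by rewrite h hf'; ring.
Qed.

(** The diagonal entry at i of the quadratic relation. *)
Lemma block_product k i : D k i ->
  A k i (s k i) * A k (s k i) i = - (A k i i - alpha) * (A k i i + 1).
Proof.
move=> Dk; have kn := D_lt Dk; have /matrixP/(_ i i) := hecke_sqr hA kn.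
rewrite mul_entry (bigD1 i) //= (bigD1 (s k i)) /= ?(eq_sym _ i) ?s_neq //.
rewrite big1 ?addr0 => [|l /andP[li ls]].
  rewrite !mxE eqxx mulr1n => h.
  by apply: (addrI (A k i i * A k i i)); rewrite h; ring.
apply/eqP; rewrite mulf_eq0; apply/orP; left; apply: contraNT ls => nz.
by apply/eqP/t_inj; rewrite t_s //; have [] := gt_edge kn _ nz; rewrite // eq_sym.
Qed.

(** The diagonal entry is -1 or alpha only if the contents of the two boxes differ
    by 1 modulo e, up to sign. They differ by at least 2, as both boxes can be
    added first, and by at most n - 1, which is less than e - 1. *)
Lemma block_neq0 k i : D k i -> A k i (s k i) * A k (s k i) i != 0.
Proof.
move=> Dk; have kn := D_lt Dk; rewrite block_product // mulf_eq0 oppr_eq0 subr_eq0 addr_eq0.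
have := jm_diag hA kn (t_jm (ltnW kn)) (t_jm kn) i.
have kz : (k < size (t i))%N by rewrite t_size; exact: ltnW.
case/andP: Dk => _ lt; set r := nth 0%N (t i) k in lt; set q := nth 0%N (t i) k.+1 in lt.
have su := yam_filled kz (t_yam i); have pu := t_yam i k.
have szu : size (take k (t i)) = k by rewrite size_takel // ltnW.
have gap := content_gap pu su lt; rewrite -/r szu in gap.
have kz1 : (k.+1 < size (t i))%N by rewrite t_size.
(* the contents differ by at least 2 *)
have far : (count_mem r (take k (t i)) + q.+1 < count_mem q (take k (t i)) + r)%N.
  have pur : dominant (rcons (take k (t i)) r) by rewrite -take_rcons //; exact: t_yam.
  have := dominant_leq pu (ltnW lt); have [er|] := eqVneq r q.+1; last by lia.
  by have := pur q; rewrite er !count_mem_rcons eqxx gtn_eqF //; lia.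
have w0 : jm_exp (t i) k = (k + r - count_mem r (take k (t i)))%N by [].
have w1 : jm_exp (t i) k.+1 = (k.+1 + q - count_mem q (take k (t i)))%N.
  by rewrite /jm_exp -/q take_rcons // count_mem_rcons -/r gtn_eqF // addn0.
have cr : (count_mem r (take k (t i)) <= k)%N by rewrite -[X in (_ <= X)%N]szu count_size.
have cq : (count_mem q (take k (t i)) <= k)%N by rewrite -[X in (_ <= X)%N]szu count_size.
move=> h; apply/negP => /orP[] /eqP ea; move: h; rewrite ea.
- have -> : alpha - (alpha - 1) = 1 by ring.
  rewrite mulr1 -expr2 -exprD => /(expr_inj_lt prim); lia.
- have -> : -1 - (alpha - 1) = - alpha by ring.
  rewrite mulrN mulrN1 mulNr => /oppr_inj.
  by rewrite mulrC => /(mulfI a0)/(expr_inj_lt prim); lia.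
Qed.

Lemma phi_block k i : D k i ->
  alpha * alpha * phi (A k i (s k i) * A k (s k i) i) = A k i (s k i) * A k (s k i) i.
Proof.
move=> Dk; rewrite block_product // rmorphM rmorphN rmorphB rmorphD rmorph1 phi_alpha.
have h := phi_diag i (D_lt Dk); set a := A k i i in h *; set f := phi a in h *.
transitivity (- (alpha * f - alpha * alpha^-1) * (alpha * f + alpha)); first by ring.
by rewrite divff // h; ring.
Qed.

(* The ratio h i / h (s k i) for which the form is preserved on the block of i. *)
Let g k i := A k (s k i) i / (alpha * phi (A k i (s k i))).

Lemma g_mul (x y x' y' z w z' w' : F) : x * y = z * w -> x' * y' = z' * w' ->
  x / (alpha * phi x') * (y / (alpha * phi y')) =
  z / (alpha * phi z') * (w / (alpha * phi w')).
Proof.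
move=> h h'; rewrite !mulf_div h; congr (_ / _).
by rewrite mulrACA -rmorphM h' rmorphM mulrACA.
Qed.

(** The products of ratios along the two sides are quotients of the same entries,
    in both directions, of A j * A k = A k * A j. *)
Lemma g_square j k i : D j i -> D k i -> (j.+1 < k)%N ->
  [/\ D k (s j i), D j (s k i), s k (s j i) = s j (s k i)
    & g j i * g k (s j i) = g k i * g j (s k i)].
Proof.
move=> Dj Dk jk; have [jn kn] := (D_lt Dj, D_lt Dk).
have [/andP[_ ltj] /andP[_ ltk]] := (Dj, Dk).
have D1 : D k (s j i).
  by rewrite /D kn !nth_s // !adj_swap_out //; lia.
have D2 : D j (s k i).
  by rewrite /D jn !nth_s // !adj_swap_out //; lia.
have eS : s k (s j i) = s j (s k i).
  by apply: t_inj; rewrite !t_s // swap_far // t_size.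
split=> //; set v := s k (s j i) in eS *; rewrite /g -/v -eS.
have vj : nth 0%N (t v) j = nth 0%N (t i) j.+1.
  by rewrite /v !nth_s // (@adj_swap_out k j) ?adj_swap_l //; lia.
have vk : nth 0%N (t v) k = nth 0%N (t i) k.+1.
  by rewrite /v !nth_s // adj_swap_l (@adj_swap_out j k.+1) //; lia.
have c : A j * A k = A k * A j := proj1 (proj1 hA) j k jk kn.
have t1 : t (s j i) = swap k (t v) by rewrite /v (t_s D1) swapK // t_size.
have t2 : t (s k i) = swap j (t v) by rewrite eS (t_s D2) swapK // t_size.
apply: g_mul.
- rewrite [LHS]mulrC [RHS]mulrC.
  rewrite -(far_path kn jn _ _ t1) -1?(far_path jn kn _ _ t2) ?c //; rewrite ?jk ?orbT //.
    by rewrite vj gtn_eqF.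
  by rewrite vk gtn_eqF.
- rewrite -(far_path jn kn _ _ (t_s Dj)) -1?(far_path kn jn _ _ (t_s Dk)) ?c //; rewrite ?jk ?orbT //.
    by rewrite vk ltn_eqF.
  by rewrite vj ltn_eqF.
Qed.

(** As for squares, with the entries between i and v of the two sides of the braid
    relation. *)
Lemma g_hexagon k i : D k i -> D k.+1 i ->
  let a := s k i in let b := s k.+1 i in
  let a' := s k.+1 a in let b' := s k b in
  [/\ [/\ D k.+1 a, D k a', D k b & D k.+1 b'], s k a' = s k.+1 b'
    & g k i * g k.+1 a * g k a' = g k.+1 i * g k b * g k.+1 b'].
Proof.
move=> Dk Dk1 a b a' b'; have [kn1 kn] := (D_lt Dk, D_lt Dk1).
have [/andP[_ lt1] /andP[_ lt2]] := (Dk, Dk1); have lt12 := ltn_trans lt2 lt1.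
have o1 : adj_swap k k.+2 = k.+2 by rewrite adj_swap_out // ltnSn orbT.
have o2 : adj_swap k.+1 k = k by rewrite adj_swap_out // ltnSn.
have sw := (o1, o2, adj_swap_l, adj_swap_r).
have Da : D k.+1 a by rewrite /D kn /a !nth_s // !sw.
have Db : D k b by rewrite /D kn1 /b !nth_s // !sw.
have Da' : D k a' by rewrite /D kn1 /a' !nth_s // !sw.
have Db' : D k.+1 b' by rewrite /D kn /b' !nth_s // !sw.
have eS : s k a' = s k.+1 b' by apply: t_inj; rewrite !t_s // swap_braid // t_size.
split=> //; rewrite /g -/a -/b -/a' -/b' -eS; set v := s k a' in eS *.
have v0 : nth 0%N (t v) k = nth 0%N (t i) k.+2.
  by rewrite /v !nth_s // !sw.
have v1 : nth 0%N (t v) k.+1 = nth 0%N (t i) k.+1.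
  by rewrite /v !nth_s // !sw.
have v2 : nth 0%N (t v) k.+2 = nth 0%N (t i) k.
  by rewrite /v !nth_s // !sw.
have ta' : t a' = swap k (t v) by rewrite /v (t_s Da') swapK // t_size.
have tb' : t b' = swap k.+1 (t v) by rewrite eS (t_s Db') swapK // t_size.
have ta : t a = swap k (t i) by rewrite t_s.
have tb : t b = swap k.+1 (t i) by rewrite t_s.
have br : A k * A k.+1 * A k = A k.+1 * A k * A k.+1 := proj2 (proj1 hA) k kn.
have [xz xy yz] : [/\ nth 0%N (t i) k != nth 0%N (t i) k.+2,
    nth 0%N (t i) k != nth 0%N (t i) k.+1 & nth 0%N (t i) k.+1 != nth 0%N (t i) k.+2].
  by rewrite !gtn_eqF.
have up : A k i a * A k.+1 a a' * A k a' v = A k.+1 i b * A k b b' * A k.+1 b' v.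
  by rewrite -(low_path kn v1 v2 xz xy yz ta ta') -(high_path kn v0 v1 xz xy yz tb tb') br.
have [zx zy yx] : [/\ nth 0%N (t v) k != nth 0%N (t v) k.+2,
    nth 0%N (t v) k != nth 0%N (t v) k.+1 & nth 0%N (t v) k.+1 != nth 0%N (t v) k.+2].
  by rewrite v0 v1 v2; split; rewrite eq_sym.
have down : A k v a' * A k.+1 a' a * A k a i = A k.+1 v b' * A k b' b * A k.+1 b i.
  have [[v0' v1'] v2'] := (esym v0, esym v1, esym v2).
  by rewrite -(low_path kn v1' v0' zx zy yx ta' ta) -(high_path kn v2' v1' zx zy yx tb' tb) br.
have gg (x y z x' y' z' : F) :
  x / (alpha * phi x') * (y / (alpha * phi y')) * (z / (alpha * phi z'))
   = z * y * x / (alpha * alpha * alpha * phi (x' * y' * z')).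
  by rewrite !mulf_div !rmorphM; congr (_ / _); ring.
by rewrite !gg up down.
Qed.

(** The conclusion is the off-diagonal part of the unitarity of A k for the form
    with diagonal entries h; the ratio g is read off from it for descents, and its
    other half follows from phi_block. *)
Lemma hermitian_diag : exists h : 'I_N -> F,
  (forall i, h i != 0 /\ phi (h i) = h i) /\
  forall k i j, (k.+1 < n)%N -> i != j -> alpha * phi (A k i j) * h i = A k j i * h j.
Proof.
have gP k i : D k i -> g k i != 0 /\ phi (g k i) = g k i.
  move=> Dk; have := block_neq0 Dk; have pb := phi_block Dk; move: pb.
  rewrite /g; set b := A k i _; set c := A k _ i; rewrite rmorphM => pb.
  rewrite mulf_eq0 negb_or => /andP[b0 c0].
  have fb0 : phi b != 0 by rewrite fmorph_eq0.
  split; first by rewrite mulf_neq0 ?invr_eq0 ?mulf_neq0.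
  rewrite rmorphM fmorphV rmorphM phi_alpha phiK.
  apply: (mulIf (mulf_neq0 a0 (mulf_neq0 fb0 b0))).
  transitivity (alpha * alpha * (phi b * phi c)); first by field; rewrite b0 a0.
  by rewrite pb; field; rewrite fb0 a0.
have G1 : (1 : F) != 0 /\ phi 1 = 1 by rewrite oner_eq0 rmorph1.
have GM x y : x != 0 /\ phi x = x -> y != 0 /\ phi y = y -> x * y != 0 /\ phi (x * y) = x * y.
  by move=> [x0 px] [y0 py]; rewrite rmorphM px py; split=> //; exact: mulf_neq0.
have Dn k i : D k i -> (k < n)%N by move=> /D_lt/ltnW.
have rank_lt k i : D k i -> (word_rank (t (s k i)) < word_rank (t i))%N.
  move=> Dk; rewrite t_s //; case/andP: Dk => kn lt.
  by apply: word_rank_swap; rewrite ?t_size.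
have [h [hP hE]] := ex_potential G1 GM gP Dn rank_lt g_square g_hexagon.
exists h; split=> // k i j kn ij.
have main i' j' : D k i' -> t j' = swap k (t i') ->
  alpha * phi (A k i' j') * h i' = A k j' i' * h j' /\
  alpha * phi (A k j' i') * h j' = A k i' j' * h i'.
  move=> Dk tj; have -> : j' = s k i' by apply: t_inj; rewrite t_s.
  have pb := phi_block Dk; have := block_neq0 Dk; rewrite rmorphM in pb.
  rewrite (hE _ _ Dk) /g; move: pb; set b := A k i' _; set c := A k _ i' => pb.
  rewrite mulf_eq0 negb_or => /andP[b0 c0].
  have fb0 : phi b != 0 by rewrite fmorph_eq0.
  split; first by field; rewrite fb0 a0.
  apply: (mulfI (mulf_neq0 a0 fb0)).
  transitivity (alpha * alpha * (phi b * phi c) * h (s k i')); first by ring.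
  by rewrite pb; field; rewrite fb0 a0.
have [z|nz] := eqVneq (A k i j) 0; last first.
  have [tj d] := gt_edge kn ij nz; case: (ltngtP (nth 0%N (t i) k) (nth 0%N (t i) k.+1)) => lt.
  - have Dj : D k j by rewrite /D kn tj !nth_swap ?t_size // adj_swap_l adj_swap_r.
    have ti : t i = swap k (t j) by rewrite tj swapK ?t_size.
    by have [] := main _ _ Dj ti.
  - have Di : D k i by rewrite /D kn.
    by have [] := main _ _ Di tj.
  - by rewrite lt eqxx in d.
have [z'|nz] := eqVneq (A k j i) 0; first by rewrite z z' rmorph0 mulr0 !mul0r.
have ji : j != i by rewrite eq_sym.
have [ti d] := gt_edge kn ji nz; case: (ltngtP (nth 0%N (t j) k) (nth 0%N (t j) k.+1)) => lt.
- have Di : D k i by rewrite /D kn ti !nth_swap ?t_size // adj_swap_l adj_swap_r.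
  have tj : t j = swap k (t i) by rewrite ti swapK ?t_size.
  by have [] := main _ _ Di tj.
- have Dj : D k j by rewrite /D kn.
  by have [] := main _ _ Dj ti.
- by rewrite lt eqxx in d.
Qed.

Definition unitary (M : 'M[F]_N) := M^T *m map_mx phi M = 1%:M.

(** The diagonal form h is the standard one in the basis rescaled by y, where
    h = y * phi y. *)
Lemma gt_unitary : (forall h, h != 0 -> phi h = h -> exists y, y * phi y = h) ->
  exists2 Y : 'M[F]_N, Y \in unitmx &
    forall k, (k.+1 < n)%N -> unitary (Y *m A k *m invmx Y).
Proof.
move=> norm; have [h [hP hE]] := hermitian_diag.
have [y yh] : exists y : 'I_N -> F, forall i, y i * phi (y i) = h i.
  apply: (@fin_all_exists _ (fun=> F) (fun i x => x * phi x = h i)) => i.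
  by have [? ?] := hP i; exact: norm.
have y0 i : y i != 0.
  by have [+ _] := hP i; rewrite -yh mulf_eq0 negb_or => /andP[].
have fy0 i : phi (y i) != 0 by rewrite fmorph_eq0.
have YV : diagf y * diagf (fun i => (y i)^-1) = 1.
  apply/matrixP => i j; rewrite mulf_diag diagfE -[1]/1%:M mxE.
  by case: eqVneq => [->|_]; rewrite ?mul0r // !mulr1n divff.
have uY : diagf y \in unitmx by have [] := mulmx1_unit YV.
have iY : invmx (diagf y) = diagf (fun i => (y i)^-1).
  by rewrite -[LHS]mulmx1 -[1%:M]YV -mulmxE mulKmx.
exists (diagf y) => // k kn; rewrite iY; set M := (X in unitary X).
have ME i j : M i j = y i * A k i j / y j by rewrite /M !mulmxE mulf_diag mul_diagf.
have MM : M * M = (alpha - 1) *: M + alpha%:M.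
  have := conj_hecke uY hA => hC; have := hecke_sqr hC kn.
  by rewrite /conj_seq iY.
clearbody M.
have phiM : alpha *: map_mx phi M = M^T - (alpha - 1)%:M.
  apply/matrixP => i j; rewrite !mxE !ME !rmorphM fmorphV.
  have [->|ij] := eqVneq i j.
    have := phi_diag j kn; rewrite mulr1n => E.
    transitivity (alpha * phi (A k j j)); first by field; rewrite fy0.
    by rewrite E; field; rewrite y0.
  rewrite mulr0n subr0; have := hE k i j kn ij; rewrite -!yh => E.
  apply: (mulIf (mulf_neq0 (y0 i) (fy0 j))).
  transitivity (alpha * phi (A k i j) * (y i * phi (y i))); first by field; rewrite fy0.
  by rewrite E; field; rewrite y0.
apply: (scalerI a0); rewrite scalemxAr phiM mulmxBr -trmx_mul mulmxE MM.
by rewrite linearD /= linearZ /= tr_scalar_mx -mulmxE mul_mx_scalar addrAC subrr add0r scalemx1.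
Qed.

End Hermitian.

(** * The involution of the field, and the theorem *)

Local Open Scope ring_scope.

(** In a cyclic group of order (Q - 1)(Q + 1), the elements killed by Q - 1 are the
    (Q + 1)-st powers. *)
Lemma finField_norm_onto (F : finFieldType) Q (h : F) : #|F| = (Q ^ 2)%N ->
  h != 0 -> h ^+ Q = h -> exists y : F, y * y ^+ Q = h.
Proof.
move=> cF h0 hQ; have Q1 : (1 < Q)%N.
  by have := finNzRing_gt1 F; rewrite cF; case: Q {cF hQ} => [|[|]].
have /cyclicP[u Du] : cyclic [set: {unit F}] by apply: field_unit_group_cyclic.
have ou : #[u]%g = ((Q - 1) * (Q + 1))%N.
  by rewrite orderE -Du card_finField_unit cF; nia.
have uh : h \is a GRing.unit by rewrite unitfE.
have /cycleP[m hm] : FinRing.unit F uh \in <[u]>%g by rewrite -Du inE.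
have hm' : h = val u ^+ m by rewrite -FinRing.val_unitX -hm.
have : (FinRing.unit F uh ^+ (Q - 1))%g == 1%g.
  apply/eqP/val_inj; rewrite FinRing.val_unitX /=; apply: (mulfI h0).
  by rewrite -exprS mulr1 subn1 prednK // ltnW.
rewrite hm -expgM -order_dvdn ou mulnC dvdn_pmul2r; last by lia.
case/dvdnP => l ml; exists (val u ^+ l).
by rewrite hm' ml -exprS -exprM addn1.
Qed.

Section Frobenius.
Variables (p : nat) (L : fieldExtType 'F_p) (alpha : L).
Hypothesis pr : prime p.
Hypothesis alpha0 : alpha != 0.
Hypothesis gen_alpha : <<1; alpha>>%VS = {:L}%VS.
Hypothesis proper : <<1; alpha + alpha^-1>>%VS <> <<1; alpha>>%VS.

Let K : {subfield L} := <<1; alpha + alpha^-1>>%AS.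
Let Q := (p ^ \dim K)%N.

Let pL : p \in [pchar L].
Proof. by rewrite pchar_lalg pchar_Fp. Qed.

Lemma frob_nat : [pchar L].-nat Q.
Proof. by rewrite pnatX pnatE // pL. Qed.

Definition frob (x : L) := x ^+ Q.

Lemma frobD : {morph frob : x y / x + y}.
Proof. by move=> x y; apply: exprDn_pchar frob_nat. Qed.

Fact frob_is_zmod : zmod_morphism frob.
Proof.
move=> x y; rewrite frobD; congr (_ + _); apply: (addrI (frob y)).
by rewrite -frobD !subrr /frob expr0n gtn_eqF // expn_gt0 prime_gt0.
Qed.
Fact frob_is_monoid : monoid_morphism frob.
Proof. by split=> [|x y]; rewrite /frob ?expr1n ?exprMn. Qed.

HB.instance Definition _ := GRing.isZmodMorphism.Build L L frob frob_is_zmod.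
HB.instance Definition _ := GRing.isMonoidMorphism.Build L L frob frob_is_monoid.

Definition frobenius : {rmorphism L -> L} := frob.

Let sK : alpha + alpha^-1 \in K. Proof. exact: memv_adjoin. Qed.

Lemma alpha_notin : alpha \notin K.
Proof.
apply/negP => aK; apply: proper; apply/eqP; rewrite eqEsubv; apply/andP; split.
  by rewrite gen_alpha subvf.
by apply/FadjoinP; rewrite sub1v.
Qed.

Lemma full_adjoin : <<K; alpha>>%VS = {:L}%VS.
Proof.
apply/eqP; rewrite eqEsubv subvf -gen_alpha /=.
by apply/FadjoinP; rewrite sub1v memv_adjoin.
Qed.

(** alpha is a root of X^2 - (alpha + alpha^-1) X + 1, which has coefficients in K. *)
Lemma adjoin_deg2 : adjoin_degree K alpha = 2.
Proof.
have n1 : adjoin_degree K alpha != 1%N by rewrite adjoin_deg_eq1 alpha_notin.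
pose f : {poly L} := 'X^2 - (alpha + alpha^-1) *: 'X + 1.
have fK : f \is a polyOver K.
  by rewrite rpredD ?rpredB ?rpredX ?polyOverX ?rpred1 // polyOverZ ?polyOverX.
have rf : root f alpha.
  by rewrite /root /f !hornerE; apply/eqP; field.
have sf : size f = 3%N.
  rewrite /f -addrA size_polyDl size_polyXn //.
  rewrite (leq_ltn_trans (size_polyD _ _)) // gtn_max size_poly1 size_polyN.
  by rewrite (leq_ltn_trans (size_scale_leq _ _)) // size_polyX.
have f0 : f != 0 by rewrite -size_poly_eq0 sf.
have := dvdp_leq f0 (minPoly_dvdp fK rf); rewrite size_minPoly sf.
have n0 : (0 < adjoin_degree K alpha)%N by [].
by move: n1 n0; case: adjoin_degree => [|[|[|]]].
Qed.

Lemma card_square : (Q ^ 2)%N = #|finvect_type L|.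
Proof.
have <- : #|{: finvect_type L}%VS| = #|finvect_type L| by apply: card_vspacef.
have dL : \dim {:L}%VS = (2 * \dim K)%N by rewrite -full_adjoin dim_Fadjoin adjoin_deg2.
rewrite card_vspace card_Fp //.
by rewrite -[\dim _]/(\dim {:L}%VS) dL mulnC expnM.
Qed.

Lemma frobK : involutive frob.
Proof.
move=> x; rewrite /frob -exprM mulnn card_square.
exact: (@expf_card (finvect_type L) x).
Qed.

(** The Frobenius map fixes alpha + alpha^-1 and moves alpha, so it exchanges
    the roots of X^2 - (alpha + alpha^-1) X + 1. *)
Lemma frob_alpha : frob alpha = alpha^-1.
Proof.
have fixK x : (x \in K) = (frob x == x) by rewrite Fermat's_little_theorem card_Fp.
have fs : frob (alpha + alpha^-1) = alpha + alpha^-1 by apply/eqP; rewrite -fixK.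
have fa : frob alpha != alpha by rewrite -fixK alpha_notin.
rewrite rmorphD fmorphV in fs.
have b0 : frob alpha != 0 by rewrite expf_neq0.
apply/eqP; rewrite -subr_eq0; apply/eqP.
have nz : frob alpha - alpha != 0 by rewrite subr_eq0.
apply: (mulIf nz); rewrite mul0r.
transitivity (frob alpha * (frob alpha + (frob alpha)^-1 - (alpha + alpha^-1))).
  by field; rewrite alpha0 b0.
by rewrite fs subrr mulr0.
Qed.

Lemma frob_norm h : h != 0 -> frob h = h -> exists y, y * frob y = h.
Proof.
move=> h0 fh; apply: (@finField_norm_onto (finvect_type L) Q h) => //.
by rewrite card_square.
Qed.
End Frobenius.

Section Unitary.
Variables (F : fieldType) (phi : {rmorphism F -> F}) (N : nat).
Implicit Types B C : 'M[F]_N.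

Lemma unitary1 : unitary phi (1%:M : 'M_N).
Proof. by rewrite /unitary map_mx1 trmx1 mulmx1. Qed.

Lemma unitaryM B C : unitary phi B -> unitary phi C -> unitary phi (B *m C).
Proof.
rewrite /unitary => uB uC; rewrite trmx_mul map_mxM mulmxA -(mulmxA C^T) uB mulmx1.
exact: uC.
Qed.

Lemma unitaryV B C : B *m C = 1%:M -> unitary phi B -> unitary phi C.
Proof.
move=> BC uB; rewrite /unitary -[C^T]mulmx1 -uB !mulmxA -trmx_mul BC trmx1 mul1mx.
by rewrite -map_mxM BC map_mx1.
Qed.

Lemma unitary_inGU Q B : (forall x, phi x = x ^+ Q) -> unitary phi B -> inGU Q B.
Proof.
move=> phiE uB; split; first by have [+ _] := mulmx1_unit uB; rewrite unitmx_tr.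
have fE (x y : 'cV[F]_N) : hermitian_form Q x y = (x^T *m map_mx phi y) 0 0.
  by rewrite mxE; apply: eq_bigr => i _; rewrite !mxE phiE.
by move=> x y; rewrite !fE trmx_mul map_mxM mulmxA -(mulmxA x^T) uB mulmx1.
Qed.
End Unitary.

Theorem proposition3p7 (n p : nat) (L : fieldExtType 'F_p) (alpha : L) (e : nat)
    (lam : seq nat) (N : nat) (R : brep L n N) :
  (0 < n)%N ->
  prime p ->
  e.-primitive_root alpha ->
  (n < e)%N ->
  e \notin [:: 2; 3; 4; 5; 6; 10]%N ->
  <<1; alpha>>%VS = {:L}%VS ->
  <<1; alpha + alpha^-1>>%VS <> <<1; alpha>>%VS ->
  is_partition n lam ->
  abs_irreducible_rep R ->
  specht_rep alpha lam R ->
  exists Q : nat,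
    (Q ^ 2)%N = #|finvect_type L| /\
    exists P : 'M[L]_N,
      P \in unitmx /\ forall x : braid n, inGU Q (P *m R x *m invmx P).
Proof.
move=> n0 pr prim ne _ gen_alpha proper _ _ spec.
have hR : hecke_rep alpha R by case: n n0 R spec {ne} => [//|m] _ R [].
have a0 := prim_root_neq0 prim.
exists (p ^ \dim <<1; alpha + alpha^-1>>%AS)%N; split; first exact: card_square.
have [P [t [uP gtP]]] := specht_gelfand_tsetlin prim ne spec.
have hA := conj_hecke uP (gen_mx_hecke hR).
have [Y uY uYA] := gt_unitary prim ne hA gtP
  (phi := frobenius alpha pr) (frob_alpha pr a0 gen_alpha proper)
  (frobK pr a0 gen_alpha proper) (frob_norm pr a0 gen_alpha proper).
have uYP : Y *m P \in unitmx by rewrite unitmx_mul uY.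
exists (Y *m P); split=> // x; apply: (@unitary_inGU _ (frobenius alpha pr)) => //.
pose T := Y *m P; pose K M := unitary (frobenius alpha pr) (T *m M *m invmx T).
have Ks i : K (R (sigma i)).
  have in1 : (i.+1 < n)%N by have := ltn_ord i; move: (i : nat) => j; case: (n).
  have := uYA i in1; rewrite /K /conj_seq gen_mx_ord; congr (unitary _ _).
  apply: (can_inj (mulmxK uYP)); rewrite [RHS]mulmxKV // !mulmxA.
  by rewrite mulmxKV // mulmxKV.
apply: (@brep_ind _ _ _ R K) => //.
- by rewrite /K mulmx1 mulmxV //; exact: unitary1.
- by move=> B C uB uC; rewrite /K -conjM //; exact: unitaryM.
- move=> i; apply: unitaryV (Ks i); rewrite conjM // brepV mulmx1 mulmxV //.
Qed.
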